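(* Let $\beta>0$ and $L>0$, and let $x\in[0,1]$. Suppose $\Theta_i=m(X_i)+\zeta_i \pmod{2\pi}$, $i=1,\dots,n$, where the $\zeta_i$ are centered i.i.d. random angles independent of the $X_i$. Assume that the $X_i$ are i.i.d. with density $f_X$ on $[0,1]$ satisfying $f_X(t)\le\mu_0$ for all $t\in[0,1]$, for some $\mu_0<\infty$, and that the $\zeta_i$ have a common density $p_\zeta$ on $\mathbb S^1$ with respect to Lebesgue measure on $\mathbb S^1$ such that there exist $p_*>0$ and $\theta_0>0$ with $$\int p_\zeta(t)\log\frac{p_\zeta(t)}{p_\zeta(t+\theta)}\,dt\le p_*\theta^2\qquad\text{for all }|\theta|\le\theta_0 .$$ Then $$\liminf_{n\to\infty}\ \inf_{T_n}\ \sup_{m\in\tilde\Sigma(\beta,L)}\mathbb E\Big[n^{\frac{2\beta}{2\beta+1}}\,d_c\big(T_n(x),m(x)\big)\Big]\ \ge\ \tilde c,$$ where $\tilde c>0$ depends only on $\beta,L,p_*$ and $\mu_0$, and the infimum is taken over all possible estimators $T_n$ based on the observations $(\Theta_i,X_i)_{i=1,\dots,n}$.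
   Context: Points of the unit circle $\mathbb S^1$ are represented by angles in $[-\pi,\pi)$. $d_c(s,t)=1-\cos(s-t)$ for real $s,t$. Densities on $\mathbb S^1$ are regarded as $2\pi$-periodic functions, and integrals over $\mathbb S^1$ are integrals over one period. A random angle $\zeta$ is centered if its mean direction is zero, i.e. $\mathbb E[\sin\zeta]=0$ and $\mathbb E[\cos\zeta]>0$. $\lfloor\beta\rfloor$ denotes the largest integer strictly smaller than $\beta$. The class $\tilde\Sigma(\beta,L)$ is the set of functions $f:[0,1]\to\mathbb S^1$ (i.e. angle-valued, with values in $[-\pi,\pi)$) such that the derivative $f^{(l)}$, $l=\lfloor\beta\rfloor$, exists and $$\sqrt{d_c\big(f^{(l)}(t),f^{(l)}(t')\big)}\le L|t-t'|^{\beta-l}\qquad\forall t,t'\in[0,1].$$ The expectation is taken under the model with regression function $m$; the laws of $X_i$ and $\zeta_i$ are fixed. *)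

(* Defs.v *)
From HB Require Import structures.
From mathcomp Require Import all_boot all_order all_algebra.
From mathcomp Require Import all_classical all_reals all_analysis.

Set Implicit Arguments.
Unset Strict Implicit.
Unset Printing Implicit Defensive.

Import Order.TTheory GRing.Theory Num.Theory.
Import numFieldTopology.Exports numFieldNormedType.Exports.

Local Open Scope classical_set_scope.
Local Open Scope ring_scope.

Section Circle.
Context {R : realType}.
Implicit Types (s t theta : R).

Definition angles : set R := `[- pi, pi[.

(* reduction modulo 2 pi to the representative in [-pi, pi[ *)
Definition wrap_angle theta : R :=
  theta - 2 * pi * (Num.floor ((theta + pi) / (2 * pi)))%:~R.

Definition d_c s t : R := 1 - cos (s - t).

(* The integrand is computed in \bar R: it is 0 where p t = 0 (0 * -oo = 0)
   and +oo where p t > 0 = p (t + theta), since 0^-1 = +oo and lne +oo = +oo. *)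
Definition kl_shift (p : R -> R) theta : \bar R :=
  (\int[lebesgue_measure]_(t in angles)
     ((p t)%:E * lne ((p t)%:E / (p (t + theta))%:E)))%E.

End Circle.

Section SmoothnessClass.
Context {R : realType}.
Implicit Types (f : R -> R) (beta L t : R).

(* Difference quotients within [0, 1], hence one-sided at the endpoints. *)
Definition quotients01 f t : set_system R :=
  (f s - f t) / (s - t) @[s --> within `[0, 1] t^'].

Definition derivable01 f : Prop :=
  forall t, t \in `[0, 1] -> cvg (quotients01 f t).

Definition derive01 f : R -> R := fun t => lim (quotients01 f t).

Definition derive01n (k : nat) f : R -> R := iter k derive01 f.

(* The largest integer STRICTLY smaller than beta (for beta > 0). *)
Definition strict_floor beta : nat := `|Num.ceil beta - 1|%N.

(* Only the values of f on [0, 1] matter. *)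
Definition Sigma_tilde beta L : set (R -> R) :=
  [set f | let l := strict_floor beta in
    [/\ forall t, t \in `[0, 1] -> angles (f t),
        forall k : nat, (k < l)%N -> derivable01 (derive01n k f) &
        forall t t', t \in `[0, 1] -> t' \in `[0, 1] ->
          Num.sqrt (d_c (derive01n l f t) (derive01n l f t'))
            <= L * `|t - t'| `^ (beta - l%:R)]].

End SmoothnessClass.

Section Model.
Context {R : realType} {d : measure_display} {Omega : measurableType d}.
Variable P : probability Omega R.

Definition mutually_independent (I : eqType) (Z : I -> Omega -> R) : Prop :=
  forall (J : seq I) (A : I -> set R), uniq J ->
    (forall i, measurable (A i)) ->
    P (\bigcap_(i in [set` J]) (Z i @^-1` A i))
      = (\prod_(i <- J) P (Z i @^-1` A i))%E.

(* The X_i and the zeta_j as one family, so that its mutual independence says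
   that each sequence is independent and that the two are independent. *)
Definition joint_family (X zeta : nat -> Omega -> R) (k : nat + nat) :
    Omega -> R :=
  match k with inl i => X i | inr j => zeta j end.

Definition has_density_on (D : set R) (Z : Omega -> R) (f : R -> R) : Prop :=
  [/\ measurable_fun D f,
      forall t, D t -> 0 <= f t &
      forall A : set R, measurable A ->
        P (Z @^-1` A) = (\int[lebesgue_measure]_(t in A `&` D) (f t)%:E)%E].

Definition centered (Z : Omega -> R) : Prop :=
  'E_P[fun w => sin (Z w)]%E = 0%E /\ (0 < 'E_P[fun w => cos (Z w)])%E.

(* Sequences are indexed from 0: the n observations have indices 0, ..., n-1. *)
Definition observations (X zeta : nat -> Omega -> R) (m : R -> R) (n : nat)
    (w : Omega) : n.-tuple (R * R) :=
  [tuple (wrap_angle (m (X i w) + zeta i w), X i w) | i < n].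

End Model.

Section Estimators.
Context {R : realType}.

Definition estimators (n : nat) : set (n.-tuple (R * R) -> R -> R) :=
  [set T | forall t : R, t \in `[0, 1] ->
     measurable_fun setT (T^~ t) /\ forall z, angles (T z t)].

End Estimators.

Arguments estimators R n : clear implicits.

Section Risk.
Context {R : realType} {d : measure_display} {Omega : measurableType d}.
Variable P : probability Omega R.

Definition scaled_risk (X zeta : nat -> Omega -> R) (beta x : R) (n : nat)
    (T : n.-tuple (R * R) -> R -> R) (m : R -> R) : \bar R :=
  ('E_P[(fun w => n%:R `^ (2 * beta / (2 * beta + 1))
                  * d_c (T (observations X zeta m n w) x) (m x))%R])%E.

Definition minimax_risk (X zeta : nat -> Omega -> R) (beta L x : R) (n : nat) :
    \bar R :=
  ereal_inf [set ereal_sup [set scaled_risk X zeta beta x T m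
                           | m in Sigma_tilde beta L]
            | T in estimators R n].

End Risk.

(* Main.v *)
Require Import Defs.
From HB Require Import structures.
From mathcomp Require Import all_boot all_order all_algebra.
From mathcomp Require Import all_classical all_reals all_analysis.
From mathcomp Require Import measurable_realfun.
From mathcomp Require Import ring lra.

Set Implicit Arguments.
Unset Strict Implicit.
Unset Printing Implicit Defensive.

Import Order.TTheory GRing.Theory Num.Theory.
Import numFieldTopology.Exports numFieldNormedType.Exports.

Local Open Scope classical_set_scope.
Local Open Scope ring_scope.

(** The rate comes from two regression functions that [n] observations cannot
    tell apart: the zero function, and a bump [m] centred at [x] with bandwidth
    [h] and height of order [h `^ beta], where [h] is [n] to the power
    [- 1 / (2 beta + 1)].  A height of this order is what membership in
    [Sigma_tilde beta L] allows ([scaled_bump_Sigma_tilde]).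

    Given the covariate [t], the laws of the angle under the two functions are
    the noise law and its rotation by [m t], so their Kullback-Leibler
    divergence is at most [pstar * m t ^+ 2].  It dominates the Hellinger
    distance ([hellinger_affinity_ge]), and averaging over the covariate, whose
    density is bounded by [mu0], leaves a loss of affinity of order
    [A ^+ 2 * h = O(1 / n)] per observation, [A] being the amplitude of the
    bump ([integral_sqr_scaled_bump]).  Affinity is multiplicative over independent
    observations, so the two samples keep an affinity of at least [1 / 2]
    ([affinity_chain]).

    The angle [T x] cannot be close to both [0] and [m x] ([d_c_separation]),
    and since the samples are not separated, one of the two risks is at least a
    multiple of [m x ^+ 2], which has the announced order [h `^ (2 beta)]
    ([two_point_bound]).

    The laws of the samples are never constructed.  The risk under [m] is
    compared with an expectation weighted by the likelihood ratio under the
    zero function ([hybrid_chain]), by replacing the observations one at a time;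
    each replacement integrates out a single noise variable by Tonelli's
    theorem on the product of [Omega], endowed with the sigma-algebra of the
    other variables, and the line ([integral_independent]), and then uses the
    rotation invariance of the circle ([integral_periodic_shift]). *)

(** * Integration without measurability, and against a density *)

Section Integration.
Context {R : realType} {d : measure_display} {T : measurableType d}.
Import HBNNSimple.

(** The integral of a nonnegative function is a supremum over the simple
    functions below it, so monotonicity costs no measurability.  This spares
    proving that the Kullback-Leibler integrand and inner integrals of
    Fubini type are measurable. *)
Lemma ge0_le_integral_any (mu : {measure set T -> \bar R}) (D : set T)
    (f g : T -> \bar R) :
  (forall x, D x -> 0 <= f x)%E -> (forall x, D x -> f x <= g x)%E ->
  (\int[mu]_(x in D) f x <= \int[mu]_(x in D) g x)%E.
Proof.
move=> f0 fg; rewrite !ge0_integralE//; last first.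
  by move=> x Dx; exact: le_trans (f0 x Dx) (fg x Dx).
apply: ereal_sup_le => _ [h hf <-]; exists h => // x.
by apply: le_trans (hf x) _; exact: lee_restrict.
Qed.

(** Meant for the Kullback-Leibler integrand, which is extended-real-valued,
    takes both signs and may fail to be integrable. *)
Lemma integral_le_of_integrable_minorant (mu : {measure set T -> \bar R})
    (D : set T) (f g : T -> \bar R) : measurable D ->
  mu.-integrable D g -> (forall x, D x -> g x <= f x)%E ->
  (\int[mu]_(x in D) g x <= \int[mu]_(x in D) f x)%E.
Proof.
move=> mD ig gf; rewrite (integralE mu D g) (integralE mu D f); apply: leeB.
  apply: ge0_le_integral_any => [x _|x Dx]; first exact: funepos_ge0.
  rewrite !funeposE; have := gf x Dx.
  by rewrite ge_max le_max le_max lexx orbT andbT => ->.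
apply: ge0_le_integral_any => [x _|x Dx]; first exact: funeneg_ge0.
rewrite !funenegE; have := gf x Dx.
by rewrite ge_max le_max le_max lexx orbT andbT leeN2 => ->.
Qed.

(** Both sides are linear in [f] and continuous along increasing sequences, so
    the simple functions approximating [f] reduce the identity to the case of
    indicator functions, which is the hypothesis on [nu]. *)
Lemma integral_density (nu mu : {measure set T -> \bar R}) (D : set T)
    (w f : T -> R) : measurable D -> measurable_fun D w ->
  (forall x, D x -> 0 <= w x) ->
  (forall A, measurable A -> nu A = \int[mu]_(x in A `&` D) (w x)%:E)%E ->
  measurable_fun setT f -> (forall x, 0 <= f x) ->
  (\int[nu]_x (f x)%:E = \int[mu]_(x in D) (f x * w x)%:E)%E.
Proof.
move=> mD mw w0 nuE mf f0.
have mEf : measurable_fun [set: T] (EFin \o f : T -> \bar R) by exact/measurable_EFinP.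
pose h := nnsfun_approx measurableT mEf.
have hf x : ((h n x)%:E @[n --> \oo] --> (f x)%:E)%E.
  by apply: (@cvg_nnsfun_approx _ _ _ _ measurableT _ mEf) => // t _; rewrite lee_fin.
have mhw n : measurable_fun D (fun x => (h n x * w x)%:E).
  apply/measurable_EFinP; apply: measurable_funM => //.
  exact: measurable_funTS.
have -> : (\int[nu]_x (f x)%:E = lim (\int[nu]_x (h n x)%:E @[n --> \oo]))%E.
  under eq_integral => x _ do rewrite -(cvg_lim _ (hf x))//.
  apply: monotone_convergence => //.
  - by move=> n; exact/measurable_EFinP.
  - by move=> n x _; rewrite lee_fin.
  - by move=> x _ a b ab; rewrite lee_fin; exact/lefP/nd_nnsfun_approx.
have -> : (\int[mu]_(x in D) (f x * w x)%:E
    = lim (\int[mu]_(x in D) (h n x * w x)%:E @[n --> \oo]))%E.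
  have hw x : ((h n x * w x)%:E @[n --> \oo] --> (f x * w x)%:E)%E.
    by rewrite EFinM; under eq_fun do rewrite EFinM; exact: cvgeZr.
  under eq_integral => x _ do rewrite -(cvg_lim _ (hw x))//.
  apply: monotone_convergence => //.
  - by move=> n x Dx; rewrite lee_fin mulr_ge0// w0.
  - move=> x Dx a b ab; rewrite lee_fin ler_wpM2r ?w0//.
    exact/lefP/nd_nnsfun_approx.
suff E n : (\int[nu]_x (h n x)%:E = \int[mu]_(x in D) (h n x * w x)%:E)%E.
  by under eq_fun do rewrite E.
transitivity (\int[nu]_x
   (\sum_(y \in range (h n)) (y * \1_(h n @^-1` [set y]) x)%:E))%E.
  by apply: eq_integral => t tE; rewrite /= fimfunE -fsumEFin.
have indich r (D' : set T) :
    measurable_fun D' (fun x => (r * \1_(h n @^-1` [set r]) x)%:E).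
  by apply: (measurable_comp measurableT) => //; exact: measurable_funM.
rewrite ge0_integral_fsum//; last first.
  by move=> m y Ey; rewrite EFinM; exact: nnfun_muleindic_ge0.
transitivity (\int[mu]_(x in D) (\sum_(y \in range (h n))
    ((y * \1_(h n @^-1` [set y]) x)%:E * (w x)%:E)))%E; last first.
  apply: eq_integral => x xE; rewrite [in RHS]fimfunE EFinM -fsumEFin//.
  by rewrite ge0_mule_fsuml => [//|y]; rewrite EFinM; exact: nnfun_muleindic_ge0.
have mwE : measurable_fun D (EFin \o w : T -> \bar R) by exact/measurable_EFinP.
rewrite ge0_integral_fsum//; last 2 first.
  - by move=> y; apply: emeasurable_funM.
  - by move=> m y Ey; rewrite mule_ge0 ?lee_fin ?w0// -lee_fin EFinM nnfun_muleindic_ge0.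
apply: eq_fsbigr => r rhn.
under eq_integral do rewrite EFinM.
rewrite integralZl_indic_nnsfun//.
under [RHS]eq_integral do rewrite EFinM -muleA.
have r0 : (0 <= r)%R by move: rhn; rewrite inE => -[t _ <-].
rewrite ge0_integralZl//; last 2 first.
  - apply: emeasurable_funM => //.
    exact/measurable_EFinP.
  - by move=> t Et; rewrite mule_ge0 ?lee_fin ?w0.
congr (_ * _)%E; under [RHS]eq_integral do rewrite muleC.
rewrite integral_indic// setIT nuE//.
rewrite [RHS](eq_integral ((EFin \o w) \_ (h n @^-1` [set r]))); last first.
  by move=> x xE; rewrite epatch_indic.
by rewrite -integral_mkcondr setIC.
Qed.

End Integration.

(** * Measurability of the inverse and of the square root *)

Section Measurability.
Context {R : realType}.

Lemma measurable_sqrtr : measurable_fun setT (@Num.sqrt R).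
Proof. by apply: continuous_measurable_fun; exact: sqrt_continuous. Qed.

(** The inverse is discontinuous at [0], so it is written as the product of the
    sign and of a power of the absolute value. *)
Lemma measurable_invr : measurable_fun setT (@GRing.inv R).
Proof.
rewrite (_ : GRing.inv = fun x : R => Num.sg x * (`|x| `^ (-1))).
  apply: measurable_funM; last first.
    exact: (measurableT_comp (@measurable_powR R (-1)) (@normr_measurable R setT)).
  apply: nondecreasing_measurable => // x y xy.
  have [x0|x0] := ltP x 0.
    rewrite (ltr0_sg x0); have [y0|y0|->] := ltgtP y 0.
    - by rewrite ltr0_sg.
    - by rewrite gtr0_sg//; lra.
    - by rewrite sgr0; lra.
  have /orP[/eqP y0|y0] : (y == 0) || (0 < y) by lra.
    by rewrite (_ : x = y)//; lra.
  have /orP[/eqP ->|x1] : (x == 0) || (0 < x) by lra.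
    by rewrite sgr0 sgr_ge0; lra.
  by rewrite !gtr0_sg.
apply/funext => x; have [->|x0] := eqVneq x 0.
  by rewrite invr0 sgr0 mul0r.
rewrite powR_inv1// [in RHS]normrEsg invfM.
by rewrite mulrA divff ?mul1r// sgr_eq0.
Qed.

End Measurability.

(** * Rotations of the circle *)

Section Circle.
Context {R : realType}.
Notation mu := (@lebesgue_measure R).
Implicit Types (c t : R).

(** A measure on the line is determined by its values on bounded intervals. *)
Lemma lebesgue_measure_shift c (A : set R) : measurable A ->
  pushforward mu (fun x : measurableTypeR R => x + c : measurableTypeR R) A
    = mu A.
Proof.
move=> mA; have mc : measurable_fun [set: measurableTypeR R]
    (fun x : measurableTypeR R => x + c : measurableTypeR R).
  exact: measurable_funD.
apply/esym/lebesgue_measure_unique => // _ [[a b]] _ <-.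
rewrite /pushforward [X in _ = mu X](_ : _ = [set` `]a - c, b - c]]); last first.
  apply/seteqP; split=> x; rewrite /= !in_itv/= ltrBlDr lerBrDr//.
by rewrite !lebesgue_measure_itv/= !lte_fin ltrD2r !EFinN -!EFinB opprB addrA subrK.
Qed.

Lemma ge0_integral_itvco_shift (f : R -> \bar R) (a b c : R) :
  measurable_fun setT f -> (forall x, 0 <= f x)%E ->
  (\int[mu]_(x in `[a, b[) f (x + c)%R = \int[mu]_(x in `[(a + c)%R, (b + c)%R[) f x)%E.
Proof.
move=> mf f0.
have mc : measurable_fun [set: measurableTypeR R]
    (fun x : measurableTypeR R => x + c : measurableTypeR R).
  exact: measurable_funD.
rewrite (_ : `[a, b[%classic =
    (fun x : measurableTypeR R => x + c : measurableTypeR R)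
      @^-1` `[(a + c)%R, (b + c)%R[); last first.
  by apply/seteqP; split=> x/=; rewrite !in_itv/= lerD2r ltrD2r.
rewrite -(ge0_integral_pushforward mc)//=; last exact: measurable_funS mf.
by apply: eq_measure_integral => A mA _; exact: lebesgue_measure_shift.
Qed.

Lemma periodic_mulrz (F : R -> R) T (k : int) t :
  periodic F T -> F (t + T * k%:~R) = F t.
Proof.
move=> pF; case: k => n.
  by rewrite -pmulrn mulr_natr periodicn.
rewrite NegzE mulrNz mulrN -[in RHS](subrK (T * n.+1%:R) t).
by rewrite mulr_natr periodicn.
Qed.

Lemma wrap_angle_periodic (F : R -> R) t : periodic F (2 * pi) ->
  F (wrap_angle t) = F t.
Proof. by move=> pF; rewrite /wrap_angle -mulrN -mulrNz periodic_mulrz. Qed.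

Lemma wrap_angleD2pi t : wrap_angle (t + 2 * pi) = wrap_angle t.
Proof.
have pi0 : pi != 0 :> R by rewrite gt_eqF// pi_gt0.
rewrite /wrap_angle.
have E (q : R) : q != 0 -> (t + 2 * q + q) / (2 * q) = (t + q) / (2 * q) + 1.
  by move=> q0; field.
rewrite E// floorDrz ?rpred1// floor1 intrD.
by move: (pi : R) (_%:~R) => q k; ring.
Qed.

Lemma wrap_angle_id t : angles t -> wrap_angle t = t.
Proof.
rewrite /angles /wrap_angle/= in_itv/= => /andP[lo hi].
have pi0 : 0 < 2 * pi :> R by rewrite mulr_gt0// pi_gt0.
rewrite (_ : Num.floor _ = 0) ?mulr0 ?subr0//.
apply/eqP; rewrite floor_eq; apply/andP; split.
  by rewrite divr_ge0// ?(ltW pi0)// -lerBlDr sub0r.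
by rewrite ltr_pdivrMr// mul1r mulr_natl mulr2n ltrD2r.
Qed.

Lemma measurable_wrap_angle : measurable_fun setT (@wrap_angle R).
Proof.
apply: measurable_funB => //; apply: measurable_funM => //.
apply: nondecreasing_measurable => // x y xy.
rewrite ler_int; apply: le_floor.
by rewrite ler_pM2r ?invr_gt0 ?mulr_gt0 ?pi_gt0// lerD2r.
Qed.

Lemma wrap_angle_in t : angles (wrap_angle t).
Proof.
rewrite /angles/= in_itv/= /wrap_angle.
have pi0 : 0 < 2 * pi :> R by rewrite mulr_gt0// pi_gt0.
have /andP[] := floor_itv ((t + pi) / (2 * pi)).
rewrite ler_pdivlMr// ltr_pdivrMr// intrD; clear pi0.
move: (pi : R) (_%:~R) => q k h1 h2; apply/andP; split; lra.
Qed.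

(** A density is known to be measurable on one period only; [wrap_angle]
    carries this to the whole line, where shifted arguments live. *)
Lemma measurable_periodic (F : R -> R) : periodic F (2 * pi) ->
  measurable_fun angles F -> measurable_fun setT F.
Proof.
move=> pF mF; rewrite (_ : F = F \o wrap_angle); last first.
  by apply/funext => t /=; rewrite wrap_angle_periodic.
apply: (measurable_comp _ _ mF) => //; first exact: measurable_itv.
- by move=> _ [t _ <-]; exact: wrap_angle_in.
- exact: measurable_wrap_angle.
Qed.

(** Rotation invariance of the uniform measure on the circle: the part of the
    period pushed past [pi] by the shift is the part freed next to [- pi],
    translated by [2 * pi]. *)
Lemma integral_periodic_shift (F : R -> R) c :
  0 <= c <= 2 * pi -> periodic F (2 * pi) -> measurable_fun setT F ->
  (forall t, 0 <= F t) ->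
  (\int[mu]_(t in angles) (F (t + c))%:E = \int[mu]_(t in angles) (F t)%:E)%E.
Proof.
rewrite /angles.
move=> /andP[c0 c2] pF mF F0.
have mE (D : set R) : measurable D -> measurable_fun D (fun x => (F x)%:E).
  by move=> mD; apply/measurable_EFinP; exact: measurable_funTS.
rewrite (@ge0_integral_itvco_shift (fun x => (F x)%:E)); last 2 first.
- exact: mE.
- by move=> x; rewrite lee_fin.
have := pi_gt0 R; move: (pi : R) pF c2 => q pF c2 q0.
rewrite (@itv_bndbnd_setU _ _ (BLeft (- q + c)) (BLeft q)); last 2 first.
- by rewrite bnd_simp; lra.
- by rewrite bnd_simp; lra.
have -> : `[(- q)%R, q[%classic = `[- q, - q + c[ `|` `[- q + c, q[.
  by rewrite -itv_bndbnd_setU// bnd_simp; lra.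
rewrite !ge0_integral_setU//; first last.
all: try by [exact: measurable_itv|exact: mE|move=> *; rewrite lee_fin|
  apply: mE; apply: measurableU].
- apply/disj_setPLR => x/=; rewrite !in_itv/= => /andP[_ h].
  by rewrite leNgt h.
- apply/disj_setPLR => x/=; rewrite !in_itv/= => /andP[_ h].
  by rewrite leNgt h.
rewrite addeC; congr (_ + _)%E.
under [RHS]eq_integral do rewrite -pF.
rewrite (@ge0_integral_itvco_shift (fun x => (F x)%:E)); last 2 first.
- exact: mE.
- by move=> x; rewrite lee_fin.
have E1 : - q + 2 * q = q by ring.
have E2 : - q + c + 2 * q = q + c by ring.
by rewrite E1 E2.
Qed.

End Circle.

(** * Integrating out one variable of an independent family *)

Section Independence.
Context {R : realType} {d : measure_display} {Omega : measurableType d}.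
Variables (P : probability Omega R) (I : eqType) (Z : I -> Omega -> R).
Hypothesis mZ : forall i, measurable_fun setT (Z i).
Hypothesis indepZ : mutually_independent P Z.

(** A pi-system generating the sigma-algebra of the variables other than
    [Z k].  Taking [Omega] itself, with this smaller sigma-algebra, as the
    space in which the other variables live avoids building their joint
    law. *)
Definition other_events (k : I) : set (set Omega) :=
  [set C | exists (J : seq I) (A : I -> set R),
    [/\ uniq J, k \notin J, forall i, measurable (A i)
      & C = \bigcap_(i in [set` J]) (Z i @^-1` A i)]].

Notation others k := (g_sigma_algebraType (other_events k)).

Lemma other_events_measurable k C : other_events k C -> measurable C.
Proof.
case=> J [A [_ _ mA ->]]; apply: fin_bigcap_measurable; first exact: finite_seq.
by move=> i _; rewrite -[_ @^-1` _]setTI; exact: mZ.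
Qed.

Lemma other_events_setI k : setI_closed (other_events k).
Proof.
move=> _ _ [J1 [A1 [uJ1 kJ1 mA1 ->]]] [J2 [A2 [uJ2 kJ2 mA2 ->]]].
exists (undup (J1 ++ J2)), (fun i => (if i \in J1 then A1 i else setT) `&`
  (if i \in J2 then A2 i else setT)); split.
- exact: undup_uniq.
- by rewrite mem_undup mem_cat negb_or kJ1.
- by move=> i; apply: measurableI; case: ifP.
- apply/seteqP; split=> [w [h1 h2] i /=|w h].
    move=> _; split.
      by case: ifPn => // iJ; exact: h1.
    by case: ifPn => // iJ; exact: h2.
  split=> i /= iJ.
    by have /= := h i; rewrite mem_undup mem_cat iJ => /(_ isT) [].
  by have /= := h i; rewrite mem_undup mem_cat iJ orbT => /(_ isT) [].
Qed.

Lemma others_sub k : <<s other_events k >> `<=` measurable.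
Proof.
apply: smallest_sub; first exact: sigma_algebra_measurable.
by move=> C; exact: other_events_measurable.
Qed.

(** Both sides are finite measures in [C], equal on the pi-system
    [other_events k] by the product rule, hence equal on the sigma-algebra
    that it generates. *)
Lemma independent_others k (C : set Omega) (B : set R) :
  <<s other_events k >> C -> measurable B ->
  P (C `&` Z k @^-1` B) = (P C * P (Z k @^-1` B))%E.
Proof.
move=> sC mB; have mZB : measurable (Z k @^-1` B).
  by rewrite -[_ @^-1` _]setTI; exact: mZ.
have c0 : 0 <= fine (P (Z k @^-1` B)) by apply: fine_ge0.
pose m2 : {measure set Omega -> \bar R} := mscale (NngNum c0) P.
suff -> : P (C `&` Z k @^-1` B) = m2 C.
  by rewrite /m2/= /mscale/= fineK ?fin_num_measure// muleC.
apply: (@g_sigma_algebra_measure_unique _ _ _ (other_events k)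
  (fun C => @other_events_measurable k C) (fun=> setT) _ _
  (mrestr P mZB) m2) => //.
- move=> _; exists [::], (fun=> setT); split=> //.
  by rewrite -[RHS]setTI; apply/seteqP; split=> // w _; split.
- by rewrite bigcup_const//; exists 0%N.
- exact: other_events_setI.
- move=> _ [J [A [uJ kJ mA ->]]]; rewrite /mrestr /m2/= /mscale/=.
  rewrite fineK ?fin_num_measure// muleC.
  pose A' i := if i == k then B else A i.
  have A'J i : i \in J -> A' i = A i.
    by rewrite /A'; case: eqP => // -> kJ'; rewrite kJ' in kJ.
  have mA' i : measurable (A' i) by rewrite /A'; case: ifP.
  transitivity (P (\bigcap_(i in [set` (k :: J)]) (Z i @^-1` A' i))).
    congr (P _); apply/seteqP; split => [w [h1 h2] i /=|w h].
      rewrite in_cons => /orP[/eqP ->|iJ]; first by rewrite /A' eqxx.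
      by rewrite A'J//; exact: h1.
    split.
      move=> i /= iJ; have /= := h i; rewrite in_cons iJ orbT => /(_ isT).
      by rewrite A'J.
    by have /= := h k; rewrite in_cons eqxx /A' eqxx => /(_ isT).
  rewrite indepZ//= ?kJ// big_cons muleC; congr (_ * _)%E.
    by rewrite indepZ//; apply: eq_big_seq => i iJ; rewrite A'J.
  by rewrite /A' eqxx.
- move=> n; apply: le_lt_trans (probability_le1 _ _) (ltry _).
  exact: measurableI.
Qed.

Definition to_others k : Omega -> others k := id.

Lemma measurable_to_others k : measurable_fun setT (to_others k).
Proof. by move=> _ B mB; rewrite setTI; exact: (@others_sub k B mB). Qed.

Lemma measurable_of_others k i :
  i != k -> measurable_fun setT (Z i : others k -> R).
Proof.
move=> ik _ B mB; rewrite setTI; apply: sub_sigma_algebra.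
exists [:: i], (fun=> B); split=> //; first by rewrite inE eq_sym.
apply/seteqP; split=> [w ZB j /=|w /(_ i)/=]; last by rewrite inE eqxx; apply.
by rewrite inE => /eqP ->.
Qed.

(** The pair formed by the other variables and [Z k] has a product law, so
    Tonelli's theorem applies and [Z k] can be integrated out first, with
    everything else frozen.  [F] sees the other variables through the point
    [w] alone: it must be measurable for their sigma-algebra. *)
Lemma integral_independent k (D : set R) (f : R -> R) (F : Omega -> R -> R) :
  measurable D -> has_density_on P D (Z k) f ->
  measurable_fun setT (fun u : others k * R => F u.1 u.2) ->
  (forall w z, 0 <= F w z) ->
  (\int[P]_w (F w (Z k w))%:E
    = \int[P]_w \int[lebesgue_measure]_(z in D) (F w z * f z)%:E)%E.
Proof.
move=> mD [mf f0 lawZ] mF F0.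
pose W : {mfun Omega >-> others k} := HB.pack_for {mfun Omega >-> others k}
  (to_others k) (isMeasurableFun.Build _ _ _ _ _ (@measurable_to_others k)).
(* Lebesgue measure lives on [measurableTypeR R], which has the sigma-algebra
   of [R] under another display. *)
have mV : measurable_fun [set: Omega] (Z k : Omega -> measurableTypeR R).
  exact: mZ.
pose V : {mfun Omega >-> measurableTypeR R} :=
  HB.pack_for {mfun Omega >-> measurableTypeR R}
  (Z k) (isMeasurableFun.Build _ _ _ _ _ mV).
have mWV : measurable_fun setT (fun w : Omega => (W w, V w)).
  by apply/measurable_fun_pair; exact: measurable_funP.
pose WV : {mfun Omega >-> (others k * measurableTypeR R)%type} :=
  HB.pack_for {mfun Omega >-> (others k * measurableTypeR R)%type}
  (fun w : Omega => (W w, V w)) (isMeasurableFun.Build _ _ _ _ _ mWV).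
pose F' (u : others k * R) : \bar R := (F u.1 u.2)%:E.
have mF' : measurable_fun setT F' by exact/measurable_EFinP.
have F'0 u : (0 <= F' u)%E by rewrite lee_fin.
transitivity (\int[distribution P WV]_u F' u)%E.
  by rewrite ge0_integral_distribution.
transitivity (\int[(distribution P W \x distribution P V)%E]_u F' u)%E.
  apply: eq_measure_integral => A mA _; apply/esym.
  apply: product_measure_unique => // B C mB mC.
  exact: independent_others.
rewrite fubini_tonelli1//= /fubini_F.
have mFF : measurable_fun setT
    (fun x : others k => \int[distribution P V]_y F' (x, y))%E.
  exact: measurable_fun_fubini_tonelli_F.
rewrite (ge0_integral_distribution W mFF); last first.
  by move=> y; exact: integral_ge0.
apply: eq_integral => w _; rewrite /F'/=.
apply: (@integral_density _ _ _ (distribution P V) lebesgue_measure D f (F w)) => //.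
exact: (measurableT_comp mF (pair1_measurable _)).
Qed.

End Independence.

(** * Hellinger affinity and Kullback-Leibler divergence *)

Section Hellinger.
Context {R : realType}.
Notation mu := (@lebesgue_measure R).

(** With [s = sqrt (b / a)] this is [ln s <= s - 1] multiplied by [2 * a].  The
    boundary cases follow the conventions of the divergence: [0] when [a = 0],
    and [+oo] when [b = 0 < a]. *)
Lemma hellinger_le_kl_pointwise (a b : R) : 0 <= a -> 0 <= b ->
  ((2 * a - 2 * Num.sqrt (a * b))%:E <= a%:E * lne (a%:E / b%:E))%E.
Proof.
rewrite le_eqVlt => /predU1P[<- _|a0].
  by rewrite mul0r sqrtr0 !mulr0 subr0 mul0e.
rewrite le_eqVlt => /predU1P[<-|b0].
  by rewrite inve0 gt0_muley ?lte_fin//= gt0_muley ?lte_fin// leey.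
rewrite inver gt_eqF// -EFinM lne_EFin ?divr_gt0// -EFinM lee_fin.
pose s := Num.sqrt (b / a).
have s0 : 0 < s by rewrite sqrtr_gt0 divr_gt0.
have sE : s ^+ 2 = b / a by rewrite sqr_sqrtr// ltW// divr_gt0.
have -> : Num.sqrt (a * b) = a * s.
  have -> : a * b = a ^+ 2 * (b / a) by field; rewrite gt_eqF.
  by rewrite sqrtrM ?sqr_ge0// sqrtr_sqr gtr0_norm.
have -> : ln (a / b) = - (ln s *+ 2).
  rewrite -lnXn// sE -lnV ?posrE ?divr_gt0//; congr ln.
  by field; rewrite !gt_eqF.
have : ln s <= s - 1.
  have := @le_ln1Dx R (s - 1); rewrite (_ : 1 + (s - 1) = s); last by ring.
  by apply; rewrite ltrBrDr addNr.
rewrite mulrN mulrnAr -mulr_natl => /(ler_wpM2l (ltW a0)); lra.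
Qed.

(** Integrating [hellinger_le_kl_pointwise] over a period gives
    [2 - 2 * affinity <= divergence], because a rotated density still has mass
    one. *)
Lemma hellinger_affinity_ge (p : R -> R) (c K : R) :
  measurable_fun setT p -> (forall z, 0 <= p z) -> periodic p (2 * pi) ->
  (\int[mu]_(z in angles) (p z)%:E = 1)%E ->
  0 <= c <= 2 * pi -> (kl_shift p (- c) <= K%:E)%E ->
  ((1 - K / 2)%:E <= \int[mu]_(z in angles) (Num.sqrt (p z * p (z - c)))%:E)%E.
Proof.
move=> mp p0 pp ip c02 klK.
have mD : measurable (angles : set R) by exact: measurable_itv.
pose q z := p (z - c).
have mq : measurable_fun setT q.
  by apply: (measurableT_comp mp); exact: measurable_funB.
have iq : (\int[mu]_(z in angles) (q z)%:E = 1)%E.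
  rewrite -(@integral_periodic_shift _ q c)//; last 2 first.
  - by move=> u; rewrite /q addrAC pp.
  - by move=> t; exact: p0.
  by under eq_integral do rewrite /q addrK.
pose h z := Num.sqrt (p z * q z).
have h0 z : 0 <= h z by exact: sqrtr_ge0.
have mh : measurable_fun setT h.
  by apply: (measurableT_comp measurable_sqrtr); exact: measurable_funM.
have mE (f : R -> R) : measurable_fun setT f ->
    measurable_fun angles (fun z => (f z)%:E : \bar R).
  by move=> mf; apply/measurable_EFinP; exact: measurable_funTS.
have integr (f : R -> R) : measurable_fun setT f -> (forall z, 0 <= f z) ->
    (\int[mu]_(z in angles) (f z)%:E < +oo)%E ->
    mu.-integrable angles (EFin \o f).
  move=> mf f0 f1; apply/integrableP; split; first exact: mE.
  under eq_integral do rewrite gee0_abs ?lee_fin//=; exact: f1.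
(* The affinity is finite: [2 * sqrt (p q) <= p + q]. *)
have h1 : (\int[mu]_(z in angles) (h z)%:E <= 1)%E.
  have : (\int[mu]_(z in angles) (h z + h z)%:E
      <= \int[mu]_(z in angles) (p z + q z)%:E)%E.
    apply: ge0_le_integral_any => z _; rewrite lee_fin ?addr_ge0//.
    have -> : p z + q z = (Num.sqrt (p z) - Num.sqrt (q z)) ^+ 2 + (h z + h z).
      have q0 : 0 <= q z by exact: p0.
      rewrite /h sqrtrM// -[in LHS](sqr_sqrtr (p0 z)) -[in LHS](sqr_sqrtr q0).
      by ring.
    by rewrite lerDr sqr_ge0.
  under eq_integral do rewrite EFinD.
  under [leRHS]eq_integral do rewrite EFinD.
  rewrite !ge0_integralD//; try by [exact: mE|move=> *; rewrite lee_fin|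
    move=> *; rewrite lee_fin; exact: p0].
  rewrite ip iq -EFinD; case: (\int[mu]_(z in angles) (h z)%:E)%E => [r||].
  - by rewrite -EFinD !lee_fin; lra.
  - by rewrite addye.
  - by move=> _; exact: leNye.
have ih : mu.-integrable angles (EFin \o h).
  by apply: integr => //; exact: le_lt_trans h1 (ltry _).
have ipp : mu.-integrable angles (EFin \o p).
  by apply: integr => //; rewrite ip ltry.
have ig : mu.-integrable angles (fun z => (2 * p z)%:E - (2 * h z)%:E)%E.
  apply: integrableB => //; under eq_fun do rewrite EFinM; exact: integrableZl.
have p0c z : 0 <= p (z + - c) by exact: p0.
have : (\int[mu]_(z in angles) ((2 * p z)%:E - (2 * h z)%:E)
    <= kl_shift p (- c))%E.
  apply: integral_le_of_integrable_minorant => // z _.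
  by rewrite -EFinB; apply: hellinger_le_kl_pointwise; [exact: p0|exact: p0c].
move=> /le_trans/(_ klK).
rewrite integralB//; last 2 first.
- by under eq_fun do rewrite EFinM; exact: integrableZl.
- by under eq_fun do rewrite EFinM; exact: integrableZl.
under eq_integral do rewrite EFinM.
under [X in (_ - X)%E]eq_integral do rewrite EFinM.
rewrite !integralZl// ip mule1.
have hfin : (\int[mu]_(z in angles) (h z)%:E)%E \is a fin_num.
  exact: integrable_fin_num.
rewrite -(fineK hfin) -EFinM -EFinB !lee_fin; lra.
Qed.

End Hellinger.

(** * The circular distance *)

Section Trig.
Context {R : realType}.
Implicit Types (s t u v : R).

(** The mean value theorem for [sin] on [[0, v]]: it gives [sin v <= v], and a
    lower bound for [sin v] as soon as [cos] is bounded below on that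
    interval. *)
Lemma sin_mean_value v : 0 <= v -> exists2 x : R, 0 <= x <= v & sin v = cos x * v.
Proof.
move=> v0.
have [|x] := @MVT_segment R sin cos 0 v v0 (fun x _ => is_derive_sin x).
  by apply: continuous_subspaceT => x; exact: continuous_sin.
by rewrite sin0 !subr0 in_itv/= => hx ->; exists x.
Qed.

Lemma subr1_cos u : 1 - cos u = 2 * sin (u / 2) ^+ 2.
Proof.
rewrite [in LHS](_ : u = (u / 2) *+ 2); last by field.
by rewrite cos_mulr2n cos2sin2; ring.
Qed.

Lemma subr1_cos_le u : 1 - cos u <= u ^+ 2 / 2.
Proof.
rewrite -cos_norm -(real_normK (num_real u)); move: `|u| (normr_ge0 u) => v v0.
rewrite subr1_cos; have v20 : 0 <= v / 2 by rewrite divr_ge0.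
have [x _ ->] := sin_mean_value v20.
have : cos x ^+ 2 <= 1.
  by rewrite -real_normK ?num_real// expr_le1// cos_max.
rewrite exprMn => h.
have := ler_wpM2r (sqr_ge0 (v / 2)) h.
lra.
Qed.

(** For [v = u / 2 <= 1 / 2] the cosine is at least [1 / 2], by the upper bound
    [subr1_cos_le], hence [sin v >= v / 2]. *)
Lemma subr1_cos_ge u : 0 <= u <= 1 -> u ^+ 2 / 8 <= 1 - cos u.
Proof.
move=> /andP[u0 u1]; rewrite subr1_cos.
have u20 : 0 <= u / 2 by rewrite divr_ge0.
have [x /andP[x0 xu] ->] := sin_mean_value u20.
have cx : 1 / 2 <= cos x.
  have := subr1_cos_le x.
  have : x ^+ 2 <= 1 by rewrite expr_le1//; lra.
  lra.
rewrite exprMn.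
have h : (1 / 2) ^+ 2 <= cos x ^+ 2 by rewrite lerXn2r// ?nnegrE; lra.
have := ler_wpM2r (sqr_ge0 (u / 2)) h.
lra.
Qed.

Lemma sqrt_d_c_le s t : Num.sqrt (d_c s t) <= `|s - t|.
Proof.
rewrite -sqrtr_sqr; apply: ler_wsqrtr; rewrite /d_c.
have := subr1_cos_le (s - t); have := sqr_ge0 (s - t); lra.
Qed.

Lemma d_c_ge0 s t : 0 <= d_c s t.
Proof. by rewrite subr_ge0 cos_le1. Qed.

(** The sum is [2 - 2 * cos (u / 2) * cos (t - u / 2)], smallest when [t] is the
    midpoint [u / 2].  The circular distance thus behaves as a squared
    distance: no [t] is close to both [0] and [u]. *)
Lemma d_c_separation t u : 0 <= u <= 1 -> u ^+ 2 / 16 <= d_c t 0 + d_c t u.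
Proof.
move=> /andP[u0 u1]; rewrite /d_c subr0.
have -> : cos t = cos (t - u / 2) * cos (u / 2) - sin (t - u / 2) * sin (u / 2).
  by rewrite -cosD subrK.
have -> : cos (t - u)
    = cos (t - u / 2) * cos (u / 2) + sin (t - u / 2) * sin (u / 2).
  by rewrite -cosB; congr cos; field.
have := @subr1_cos_ge (u / 2); rewrite divr_ge0//= => /(_ _).
have -> : u / 2 <= 1 by lra.
move=> /(_ isT).
have c0 : 0 <= cos (u / 2).
  have := subr1_cos_le (u / 2).
  have : (u / 2) ^+ 2 <= 1 by rewrite expr_le1// ?divr_ge0//; lra.
  lra.
have := ler_wpM2r c0 (cos_le1 (t - u / 2)).
rewrite mul1r expr_div_n; lra.
Qed.

(** A pointwise form of the comparison between the testing affinity and the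
    Hellinger affinity: [a + l * b >= e * min 1 l], and the inequality between
    arithmetic and geometric means bounds [sqrt l / 2] by
    [min 1 l + (1 + l) / 16].  Stated without the minimum, the inequality
    involves, besides the losses, only [sqrt l] and [l], whose expectations are
    under control. *)
Lemma le_cam_pointwise (a b l : R) : 0 <= a -> 0 <= b -> 0 <= l ->
  forall e, 0 <= e -> e <= a + b ->
  e * Num.sqrt l / 2 <= a + l * b + e * (1 + l) / 16.
Proof.
move=> a0 b0 l0 e e0 eab.
set s := Num.sqrt l; have s0 : 0 <= s := sqrtr_ge0 _.
have lE : l = s ^+ 2 by rewrite sqr_sqrtr.
have [l1|l1] := leP l 1.
  have h : e * l <= a + l * b.
    apply: (@le_trans _ _ ((a + b) * l)); first exact: ler_wpM2r.
    by rewrite mulrDl [b * l]mulrC lerD2r ler_piMr.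
  have : 0 <= e * ((s - 1 / 4) ^+ 2) by rewrite mulr_ge0// sqr_ge0.
  rewrite lE in h *.
  nra.
have h : e <= a + l * b.
  by apply: le_trans eab _; rewrite lerD2l ler_peMl// ltW.
have : 0 <= e * ((s - 4) ^+ 2) by rewrite mulr_ge0// sqr_ge0.
rewrite lE.
nra.
Qed.

End Trig.

(** * Derivatives within the unit interval *)

Section Derivatives01.
Context {R : realType}.
Implicit Types (f F : R -> R) (t : R).

(** No point of the interval is isolated in it, so limits of difference
    quotients are unique. *)
Lemma proper_within01 t : t \in `[0, 1] ->
  ProperFilter (within `[0, 1] t^').
Proof.
rewrite in_itv/= => /andP[t0 t1]; apply: Build_ProperFilter => -[e /= e0 H].
have [tl|tl] := ltP t 1.
  pose s := t + Num.min (e / 2) (1 - t).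
  have m0 : 0 < Num.min (e / 2) (1 - t) by rewrite lt_min divr_gt0//= subr_gt0.
  apply: (H s) => /=.
  - rewrite /ball/= /s opprD addNKr normrN gtr0_norm//.
    by rewrite gt_min ltr_pdivrMr// mulr_natr mulr2n ltrDl e0.
  - by rewrite /s eq_sym -subr_eq0 opprD addNKr oppr_eq0 gt_eqF.
  - rewrite in_itv/= addr_ge0 ?(ltW m0)//=.
    by rewrite /s -lerBrDl ge_min lexx orbT.
have {t1 tl} t1 : t = 1 by apply/eqP; rewrite eq_le t1.
pose s := t - Num.min (e / 2) 1.
have m0 : 0 < Num.min (e / 2) 1 by rewrite lt_min divr_gt0//=.
apply: (H s) => /=.
- rewrite /ball/= /s subKr gtr0_norm//.
  by rewrite gt_min ltr_pdivrMr// mulr_natr mulr2n ltrDl e0.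
- by rewrite /s eq_sym -subr_eq0 subKr gt_eqF.
- by rewrite in_itv/= /s t1 subr_ge0 ge_min lexx orbT/= lerBlDr lerDl ltW.
Qed.

(** [f] and [F] need agree on [[0, 1]] only: iterated derivatives taken within
    the interval have meaningless values outside it. *)
Lemma cvg_quotients01 f F t l : t \in `[0, 1] ->
  (forall s, s \in `[0, 1] -> f s = F s) -> is_derive t 1 F l ->
  quotients01 f t --> l.
Proof.
move=> t01 fF [dF lE].
have : h^-1 *: ((F \o shift t) (h *: 1) - F t) @[h --> 0^'] --> l.
  by rewrite -lE; exact: dF.
move=> /cvgrPdist_lt cF; apply/cvgrPdist_lt => e e0.
have [d /= d0 H] := cF _ e0.
exists d => //= s sd st s01.
have := H (s - t); rewrite /= /ball/= sub0r normrN distrC => /(_ sd).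
rewrite subr_eq0 => /(_ st).
rewrite [(s - t) *: 1]mulr1 subrK !fF//.
by rewrite -[_ *: _]/(_ * _) mulrC.
Qed.

Lemma derive01n_derivatives (F : nat -> R -> R) :
  (forall k t, is_derive t 1 (F k) (F k.+1 t)) ->
  forall k t, t \in `[0, 1] -> derive01n k (F 0%N) t = F k t.
Proof.
move=> dF; elim=> [//|k IH] t t01.
rewrite /derive01n iterS -/(derive01n k _) /derive01.
have := cvg_quotients01 t01 IH (dF k t).
have pf := proper_within01 t01.
exact: cvg_lim.
Qed.

Lemma derivable01n_derivatives (F : nat -> R -> R) :
  (forall k t, is_derive t 1 (F k) (F k.+1 t)) ->
  forall k, derivable01 (derive01n k (F 0%N)).
Proof.
move=> dF k t t01; apply/cvg_ex; exists (F k.+1 t).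
exact: cvg_quotients01 t01 (derive01n_derivatives dF k) (dF k t).
Qed.

Lemma continuous_of_derivative F (F' : R -> R) :
  (forall t, is_derive t 1 F (F' t)) -> continuous F.
Proof.
move=> dF t; apply/differentiable_continuous.
by apply/derivable1_diffP; case: (dF t).
Qed.

Lemma lipschitz_of_derivative F (F' : R -> R) M : (forall t, is_derive t 1 F (F' t)) ->
  (forall t, `|F' t| <= M) -> forall s t, `|F s - F t| <= M * `|s - t|.
Proof.
move=> dF FM s t; wlog st : s t / t <= s => [H|].
  have [/H//|/ltW/H] := leP t s.
  by rewrite distrC [`|t - s|]distrC.
have [|x _ ->] := @MVT_segment R F F' t s st (fun x _ => dF x).
  by apply: continuous_subspaceT; exact: continuous_of_derivative dF.
by rewrite normrM ler_wpM2r.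
Qed.

(** The Lipschitz bound serves for increments at most [1], since
    [u <= u `^ g] there, and boundedness for the larger ones. *)
Lemma holder_of_bounded_lipschitz (F : R -> R) M g : 0 < g <= 1 ->
  (forall t, `|F t| <= M) -> (forall s t, `|F s - F t| <= M * `|s - t|) ->
  forall s t, `|F s - F t| <= 2 * M * `|s - t| `^ g.
Proof.
move=> /andP[g0 g1] FM FL s t.
have M0 : 0 <= M by exact: le_trans (FM 0).
set u := `|s - t|; have u0 : 0 <= u by exact: normr_ge0.
have [u1|u1] := leP u 1.
  apply: le_trans (FL s t) _; rewrite -/u.
  have [->|un0] := eqVneq u 0; first by rewrite mulr0 mulr_ge0 ?powR_ge0// mulr_ge0.
  have up : 0 < u by rewrite lt_def un0.
  have : u <= u `^ g.
    by apply: ger1_powR => //; rewrite up.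
  have := powR_ge0 u g; nra.
have h : `|F s - F t| <= 2 * M.
  by apply: le_trans (ler_normB _ _) _; rewrite mulr_natl mulr2n lerD.
have : 1 <= u `^ g by rewrite -[leLHS](powRr0 u) ler_powR// ltW//.
nra.
Qed.

End Derivatives01.

(** * A bump function with all derivatives bounded *)

Section Bump.
Context {R : realType}.
Implicit Types (t u : R).

(** The bump is the derivative of the logistic function, which satisfies
    [logistic' = logistic - logistic ^+ 2].  Each derivative of the bump is
    therefore a polynomial in [logistic], whose values lie in [[0, 1]], so all
    derivatives are bounded. *)
Definition logistic u : R := (1 + expR (- u))^-1.

Lemma logistic_gt0 u : 0 < logistic u.
Proof. by rewrite invr_gt0 addr_gt0 ?expR_gt0. Qed.

Lemma logistic_le1 u : logistic u <= 1.
Proof. by rewrite invf_le1 ?addr_gt0 ?expR_gt0// lerDl expR_ge0. Qed.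

Lemma is_derive_logistic u :
  is_derive u 1 logistic (logistic u - logistic u ^+ 2).
Proof.
have n0 : 1 + expR (- u) != 0 by rewrite gt_eqF// addr_gt0 ?expR_gt0.
have dE : is_derive u 1 (fun x => 1 + expR (- x)) (- expR (- u)).
  have dexp := is_derive1_comp (is_derive_expR (- u)) (is_deriveNid u 1).
  have := is_deriveD (is_derive_cst (1 : R) u 1) dexp.
  by move=> H; apply: (is_derive_eq H); rewrite add0r mulrN1.
have := @is_deriveV _ (fun x => 1 + expR (- x)) u _ _ n0 dE.
set D := (X in is_derive _ _ _ X) => H.
suff <- : D = logistic u - logistic u ^+ 2 by [].
rewrite /D /logistic /= -[_ *: _]/(_ * _); field.
exact: n0.
Qed.

(** The chain rule turns [P(logistic)] into
    [(P' * ('X - 'X ^+ 2))(logistic)]. *)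
Fixpoint bump_poly (k : nat) : {poly R} :=
  if k is k'.+1 then (bump_poly k')^`() * ('X - 'X ^+ 2) else 'X - 'X ^+ 2.

(** The [k]-th derivative of the bump of amplitude [A] and bandwidth [h]
    centred at [x]. *)
Definition scaled_bump (A h x : R) (k : nat) t : R :=
  A * h ^- k * (bump_poly k).[logistic ((t - x) / h)].

Lemma is_derive_scaled_logistic h x t :
  is_derive t 1 (fun s => logistic ((s - x) / h))
    ((logistic ((t - x) / h) - logistic ((t - x) / h) ^+ 2) / h).
Proof.
have d1 : is_derive t 1 (fun s : R => (s - x) / h) h^-1.
  have -> : (fun s : R => (s - x) / h) = (fun s : R => h^-1 *: (s - x)).
    by apply/funext => s; rewrite mulrC.
  apply: is_derive_eq.
  by rewrite subr0 -[_ *: _]/(_ * _) mulr1.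
exact: (@is_derive1_comp _ logistic (fun s => (s - x) / h) t _ _
  (is_derive_logistic ((t - x) / h)) d1).
Qed.

Lemma is_derive_scaled_bump A h x k t :
  is_derive t 1 (scaled_bump A h x k) (scaled_bump A h x k.+1 t).
Proof.
have d2 := is_derive_scaled_logistic h x t.
have d3 := is_derive1_comp (is_derive_poly (bump_poly k) _) d2.
have d4 := is_deriveZ (A * h ^- k) d3.
apply: (is_derive_eq d4).
have hk : h ^- k.+1 = h ^- k * h^-1 by rewrite exprSr invfM.
rewrite /scaled_bump hk/= hornerM hornerD hornerN hornerX hornerXn -[_ *: _]/(_ * _).
ring.
Qed.

Lemma poly_bounded01 (p : {poly R}) :
  exists2 M : R, 0 <= M & forall u, 0 <= u <= 1 -> `|p.[u]| <= M.
Proof.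
elim/poly_ind: p => [|p c [M M0 IH]].
  by exists 0 => // u _; rewrite horner0 normr0.
exists (M + `|c|) => [|u /[dup] u01 /andP[u0 u1]]; first by rewrite addr_ge0.
rewrite !hornerE; apply: le_trans (ler_normD _ _) _; rewrite lerD2r.
rewrite normrM -[leRHS]mulr1 ler_pM// ?IH// ger0_norm//.
Qed.

Lemma scaled_bump0E A h x t : scaled_bump A h x 0 t
  = A * (logistic ((t - x) / h) - logistic ((t - x) / h) ^+ 2).
Proof. by rewrite /scaled_bump/= !hornerE expr0 invr1 mulr1. Qed.

Lemma logistic_bump_bounds u : 0 <= logistic u - logistic u ^+ 2 <= 1 / 4.
Proof.
have := logistic_gt0 u; have := logistic_le1 u.
move: (logistic u) => s s1 s0; apply/andP; split; first by nra.
by have := sqr_ge0 (s - 1 / 2); lra.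
Qed.

Lemma scaled_bump_peak A h x : scaled_bump A h x 0 x = A / 4.
Proof.
rewrite scaled_bump0E subrr mul0r /logistic oppr0 expR0.
by rewrite -[1 + 1]/(2 : R); field.
Qed.

Lemma scaled_bump_bounds A h x t : 0 <= A ->
  0 <= scaled_bump A h x 0 t <= A / 4.
Proof.
move=> A0; rewrite scaled_bump0E; have /andP[s0 s1] := logistic_bump_bounds ((t - x) / h).
by apply/andP; split; [rewrite mulr_ge0|have := ler_wpM2l A0 s1; lra].
Qed.

Lemma measurable_scaled_bump A h x k : measurable_fun setT (scaled_bump A h x k).
Proof.
apply: continuous_measurable_fun.
exact: continuous_of_derivative (is_derive_scaled_bump A h x k).
Qed.

(** The bump takes values in [[0, 1]], so its square is at most itself, and the
    integral of the unscaled bump is an increment of [logistic], at most [1].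
    The scaling contributes [A ^+ 2 * h]. *)
Lemma integral_sqr_scaled_bump A h x : 0 < h ->
  (\int[lebesgue_measure]_(t in `[0%R, 1%R]) (scaled_bump A h x 0 t ^+ 2)%:E
    <= (A ^+ 2 * h)%:E)%E.
Proof.
move=> h0; pose s t := logistic ((t - x) / h).
have ds t : is_derive t 1 s ((s t - s t ^+ 2) / h).
  exact: is_derive_scaled_logistic.
have dS t : is_derive t 1 (fun t => A ^+ 2 * h * s t) (A ^+ 2 * (s t - s t ^+ 2)).
  have d4 := is_deriveZ (A ^+ 2 * h) (ds t).
  apply: (is_derive_eq d4); rewrite -[_ *: _]/(_ * _); field.
  by rewrite gt_eqF.
have cs : continuous s by exact: continuous_of_derivative ds.
have cS := continuous_of_derivative dS.
(* [A ^+ 2 * h * s] is the primitive of the squared amplitude times the bump. *)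
have FTC : (\int[lebesgue_measure]_(t in `[0%R, 1%R]) (A ^+ 2 * (s t - s t ^+ 2))%:E
    = (A ^+ 2 * h * s 1)%:E - (A ^+ 2 * h * s 0)%:E)%E.
  apply: (@continuous_FTC2 _ (fun t => A ^+ 2 * (s t - s t ^+ 2))
    (fun t => A ^+ 2 * h * s t)) => //.
  - apply: continuous_subspaceT => t; apply: cvgM; first exact: cvg_cst.
    by apply: cvgB; [exact: cs|apply: cvgM; exact: cs].
  - split.
    + by move=> t _; case: (dS t).
    + by apply: cvg_at_right_filter; exact: cS.
    + by apply: cvg_at_left_filter; exact: cS.
  - by move=> t _; rewrite derive1E; case: (dS t).
apply: (@le_trans _ _ (A ^+ 2 * h * s 1 - A ^+ 2 * h * s 0)%:E); last first.
  rewrite lee_fin; have := logistic_le1 ((1 - x) / h).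
  have := logistic_gt0 ((0 - x) / h); rewrite -/(s 0) -/(s 1).
  have : 0 <= A ^+ 2 * h by rewrite mulr_ge0 ?sqr_ge0// ltW.
  nra.
rewrite EFinB -FTC; apply: ge0_le_integral => //.
- by move=> t _; rewrite lee_fin sqr_ge0.
- apply/measurable_EFinP; apply: measurable_funX.
  by apply: measurable_funTS; exact: measurable_scaled_bump.
- apply/measurable_EFinP; apply: measurable_funTS.
  apply: measurable_funM => //; apply: measurable_funB.
    exact: continuous_measurable_fun.
  by apply: measurable_funX; exact: continuous_measurable_fun.
- move=> t _; rewrite lee_fin scaled_bump0E exprMn -/(s t).
  rewrite ler_wpM2l ?sqr_ge0//.
  have /andP[] := logistic_bump_bounds ((t - x) / h); rewrite -/(s t).
  set v := s t - _ => v0 v1; nra.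
Qed.

Lemma strict_floor_bounds (beta : R) : 0 < beta ->
  0 < beta - (strict_floor beta)%:R <= 1.
Proof.
move=> b0; rewrite /strict_floor.
have c1 : 0 <= Num.ceil beta - 1.
  by rewrite subr_ge0 -gtz0_ge1 ceil_gt0.
rewrite natr_absz ger0_norm//.
have /andP[h1 h2] := ceil_itv beta.
rewrite subr_gt0 h1/=; rewrite intrD in h1 *.
rewrite lerBlDr; apply: le_trans h2 _; rewrite rmorphN /=; lra.
Qed.

(** With amplitude [a * h `^ beta], the derivative of order
    [l = strict_floor beta] has size [a * h `^ (beta - l)] and varies at scale
    [h], so its Holder constant of order [beta - l] is a multiple of [a]
    independent of [h]. *)
Lemma scaled_bump_Sigma_tilde (beta L : R) : 0 < beta -> 0 < L ->
  exists2 a0 : R, 0 < a0 & forall a h x : R, 0 <= a <= a0 -> 0 < h <= 1 ->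
    Sigma_tilde beta L (scaled_bump (a * h `^ beta) h x 0).
Proof.
move=> b0 L0; have /andP[g0 g1] := strict_floor_bounds b0.
set l := strict_floor beta in g0 g1 *; set g := beta - l%:R in g0 g1.
have [M0 M00 hM0] := poly_bounded01 (bump_poly l).
have [M1 M10 hM1] := poly_bounded01 (bump_poly l.+1).
pose M := M0 + M1 + 1.
have M_gt0 : 0 < M by rewrite /M; lra.
exists (Num.min 1 (L / (2 * M))); first by rewrite lt_min ltr01 divr_gt0// mulr_gt0.
move=> a h x; rewrite le_min => /and3P[a0 a1 aL] /andP[h0 h1].
set A := a * h `^ beta.
have hb1 : h `^ beta <= 1.
  have <- : 1 `^ beta = 1 :> R by rewrite powR1.
  by rewrite ge0_ler_powR// ?nnegrE// ltW.
have A0 : 0 <= A by rewrite mulr_ge0// powR_ge0.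
have A1 : A <= 1 by rewrite /A -[leRHS]mulr1 ler_pM// powR_ge0.
have dF := is_derive_scaled_bump A h x.
split.
- move=> t _; have /andP[m0 m1] := scaled_bump_bounds h x t A0.
  rewrite /angles/= in_itv/=; apply/andP; split.
    by apply: le_trans m0; rewrite oppr_le0 pi_ge0.
  have := @pi_ge2 R; lra.
- by move=> k _; exact: derivable01n_derivatives.
- move=> t t' t01 t'01; rewrite !(derive01n_derivatives dF)//.
  apply: le_trans (sqrt_d_c_le _ _) _.
  pose G u := (bump_poly l).[logistic u].
  have log01 u : 0 <= logistic u <= 1 by rewrite ltW ?logistic_gt0// logistic_le1.
  have dG u : is_derive u 1 G (bump_poly l.+1).[logistic u].
    have := is_derive1_comp (is_derive_poly (bump_poly l) _) (is_derive_logistic u).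
    move=> H; apply: (is_derive_eq H).
    by rewrite /= hornerM hornerD hornerN hornerX hornerXn.
  have GM u : `|G u| <= M by apply: le_trans (hM0 _ (log01 u)) _; rewrite /M; lra.
  have GL := lipschitz_of_derivative dG (M := M).
  have {}GL s1 s2 : `|G s1 - G s2| <= M * `|s1 - s2|.
    apply: GL => u; apply: le_trans (hM1 _ (log01 u)) _; rewrite /M; lra.
  have g01 : 0 < g <= 1 by rewrite g0.
  have GH := holder_of_bounded_lipschitz g01 GM GL.
  have := GH ((t - x) / h) ((t' - x) / h).
  have -> : (t - x) / h - (t' - x) / h = (t - t') / h by field; rewrite gt_eqF.
  rewrite normrM normfV (gtr0_norm h0) powRM ?invr_ge0 ?(ltW h0)// => H.
  rewrite /scaled_bump -/(G _) -/(G _) -mulrBr normrM.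
  (* The powers of [h] cancel exactly. *)
  have hl : h `^ beta * h ^- l * (h^-1 `^ g) = 1.
    rewrite -(powR_inv1 (ltW h0)) -powRrM mulN1r -(powR_invn _ (ltW h0)).
    rewrite -!powRD ?(gt_eqF h0) ?implybT//.
    have -> : beta + - l%:R + - g = 0 by rewrite /g; ring.
    by rewrite powRr0.
  rewrite ger0_norm; last by rewrite mulr_ge0// invr_ge0 exprn_ge0// ltW.
  have C0 : 0 <= A * h ^- l by rewrite mulr_ge0// invr_ge0 exprn_ge0// ltW.
  apply: le_trans (ler_wpM2l C0 H) _.
  have -> : A * h ^- l * (2 * M * (`|t - t'| `^ g * h^-1 `^ g))
      = (a * (2 * M)) * `|t - t'| `^ g * (h `^ beta * h ^- l * (h^-1 `^ g)).
    by rewrite /A; ring.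
  rewrite hl mulr1 ler_wpM2r ?powR_ge0//.
  by move: aL; rewrite ler_pdivlMr// mulr_gt0.
Qed.

End Bump.

(** * Likelihood ratio between two regression functions *)

Section LikelihoodRatio.
Context {R : realType} {d : measure_display} {Omega : measurableType d}.
Variables (P : probability Omega R) (X zeta : nat -> {RV P >-> R}).
Variables (fX p m : R -> R).
Hypothesis indep : mutually_independent P (joint_family X zeta).
Hypothesis zeta_angles : forall i w, angles (zeta i w).
Hypothesis law_X : forall i, has_density_on P `[0, 1] (X i) fX.
Hypothesis law_zeta : forall i, has_density_on P angles (zeta i) p.
Hypothesis p_periodic : periodic p (2 * pi).
Hypothesis mm : measurable_fun setT m.
Hypothesis m_bounds : forall t, 0 <= m t <= 2 * pi.

Notation Z := (joint_family X zeta).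
Notation others k := (g_sigma_algebraType (other_events (joint_family X zeta) k)).
Notation leb := (@lebesgue_measure R).

(** The conditional density of an observed angle given its covariate, under the
    regression function [m], relative to the one under the zero function.
    Where [p z = 0] the quotient is [0], so the part of the law under [m] that
    is singular with respect to the other is dropped. *)
Definition likelihood_ratio (z x : R) : R := p (z - m x) / p z.

Lemma measurable_joint_family k : measurable_fun setT (Z k).
Proof. by case: k => i; exact: measurable_funP. Qed.

Lemma noise_density_ge0 z : 0 <= p z.
Proof.
rewrite -(wrap_angle_periodic z p_periodic).
by have [_ + _] := law_zeta 0; apply; exact: wrap_angle_in.
Qed.

Lemma measurable_noise_density : measurable_fun setT p.
Proof.
by apply: measurable_periodic => //; have [] := law_zeta 0.
Qed.

Lemma likelihood_ratio_ge0 z x : 0 <= likelihood_ratio z x.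
Proof. by rewrite divr_ge0 ?noise_density_ge0. Qed.

Lemma measurable_likelihood_ratio d' (T : measurableType d') (f g : T -> R) :
  measurable_fun setT f -> measurable_fun setT g ->
  measurable_fun setT (fun t => likelihood_ratio (f t) (g t)).
Proof.
move=> mf mg; have mp := measurable_noise_density; apply: measurable_funM.
  apply: (measurableT_comp mp); apply: measurable_funB => //.
  exact: (measurableT_comp mm).
by apply: (measurableT_comp measurable_invr); exact: (measurableT_comp mp).
Qed.

Definition partial_ratio (k : nat) (w : Omega) : R :=
  \prod_(i < k) likelihood_ratio (zeta i w) (X i w).

Lemma partial_ratio_ge0 k w : 0 <= partial_ratio k w.
Proof. by apply: prodr_ge0 => i _; exact: likelihood_ratio_ge0. Qed.

Lemma partial_ratioS k w : partial_ratio k.+1 w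
  = partial_ratio k w * likelihood_ratio (zeta k w) (X k w).
Proof. exact: big_ord_recr. Qed.

Lemma measurable_others_X c i : c != inl i ->
  measurable_fun setT (X i : others c -> R).
Proof.
by move=> ci; apply: (@measurable_of_others _ _ _ _ Z c (inl i)); rewrite eq_sym.
Qed.

Lemma measurable_others_zeta c i : c != inr i ->
  measurable_fun setT (zeta i : others c -> R).
Proof.
by move=> ci; apply: (@measurable_of_others _ _ _ _ Z c (inr i)); rewrite eq_sym.
Qed.

Lemma measurable_partial_ratio_others c k :
  (forall i, (i < k)%N -> c != inl i) -> (forall i, (i < k)%N -> c != inr i) ->
  measurable_fun setT (partial_ratio k : others c -> R).
Proof.
move=> cl cr; apply: (@measurable_prod _ (others c) _ _ _ _
  (fun (i : 'I_k) w => likelihood_ratio (zeta i w) (X i w))) => i _.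
apply: measurable_likelihood_ratio.
  by apply: measurable_others_zeta; exact: cr.
by apply: measurable_others_X; exact: cl.
Qed.

Lemma measurable_partial_ratio k : measurable_fun setT (partial_ratio k).
Proof.
apply: (@measurable_prod _ Omega _ _ _ _
  (fun (i : 'I_k) w => likelihood_ratio (zeta i w) (X i w))) => i _.
by apply: measurable_likelihood_ratio; exact: measurable_funP.
Qed.

(** A sample interpolating between the two models: the first [k] observations
    follow the zero regression function, the others follow [m]. *)
Definition hybrid n k (w : Omega) : n.-tuple (R * R) :=
  [tuple (if (i < k)%N then zeta i w
          else wrap_angle (m (X i w) + zeta i w), X i w) | i < n].

(** [hybrid n k] with its [k]-th angle left free, the one variable that
    separates [hybrid n k] from [hybrid n k.+1]. *)
Definition hybrid_set n k (w : Omega) (z : R) : n.-tuple (R * R) :=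
  [tuple (if i == k :> nat then z
          else if (i < k)%N then zeta i w
          else wrap_angle (m (X i w) + zeta i w), X i w) | i < n].

Lemma hybrid_set_wrap n k w :
  hybrid_set n k w (wrap_angle (m (X k w) + zeta k w)) = hybrid n k w.
Proof.
apply: eq_from_tnth => i; rewrite !tnth_mktuple; case: eqP => // ->.
by rewrite ltnn.
Qed.

Lemma hybrid_setS n k w : hybrid_set n k w (zeta k w) = hybrid n k.+1 w.
Proof.
apply: eq_from_tnth => i; rewrite !tnth_mktuple [in RHS]ltnS [in RHS]leq_eqVlt.
by case: eqP => //= ->.
Qed.

Lemma measurable_hybrid_set n k (f : others (inr k) * R -> R) :
  measurable_fun setT f ->
  measurable_fun setT (fun u : others (inr k) * R => hybrid_set n k u.1 (f u)).
Proof.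
move=> mf; apply/measurable_fun_tnthP => i.
rewrite (_ : _ \o _ = fun u : others (inr k) * R =>
  (if i == k :> nat then f u else if (i < k)%N then zeta i u.1
     else wrap_angle (m (X i u.1) + zeta i u.1), X i u.1)); last first.
  by apply/funext => u /=; rewrite tnth_mktuple.
have mX : measurable_fun setT (fun u : others (inr k) * R => X i u.1).
  exact: (measurableT_comp (measurable_others_X _) measurable_fst).
apply/measurable_fun_pair => //.
have [//|ik] := eqVneq (i : nat) k.
have mz : measurable_fun setT (fun u : others (inr k) * R => zeta i u.1).
  apply: (measurableT_comp (measurable_others_zeta _) measurable_fst).
  by apply: contra ik => /eqP[->].
case: (i < k)%N => //; apply: (measurableT_comp measurable_wrap_angle).
by apply: measurable_funD => //; exact: (measurableT_comp mm).
Qed.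

(** Freeze everything but the [k]-th noise variable and integrate it out.
    Rotating the circle by [m (X k w)] moves the shift from the sample to the
    density, which becomes [p (z - m (X k w))]; this is at least
    [likelihood_ratio z (X k w) * p z]. *)
Lemma hybrid_step n k (g : n.-tuple (R * R) -> R) :
  measurable_fun setT g -> (forall y, 0 <= g y) ->
  (\int[P]_w (g (hybrid n k.+1 w) * partial_ratio k.+1 w)%:E
    <= \int[P]_w (g (hybrid n k w) * partial_ratio k w)%:E)%E.
Proof.
move=> mg g0; have mp := measurable_noise_density.
have mD : measurable (angles : set R) by exact: measurable_itv.
have mL : measurable_fun setT (fun u : others (inr k) * R => partial_ratio k u.1).
  apply: (measurableT_comp (measurable_partial_ratio_others _ _) measurable_fst) => i ik.
    by apply/eqP.
  by apply/eqP => -[ki]; rewrite ki ltnn in ik.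
have mXk : measurable_fun setT (fun u : others (inr k) * R => X k u.1).
  exact: (measurableT_comp (measurable_others_X _) measurable_fst).
pose F1 w z := g (hybrid_set n k w z) * partial_ratio k w * likelihood_ratio z (X k w).
pose F2 w z := g (hybrid_set n k w (wrap_angle (m (X k w) + z))) * partial_ratio k w.
have F10 w z : 0 <= F1 w z.
  by rewrite mulr_ge0 ?likelihood_ratio_ge0// mulr_ge0// partial_ratio_ge0.
have F20 w z : 0 <= F2 w z by rewrite mulr_ge0// partial_ratio_ge0.
have mF1 : measurable_fun setT (fun u : others (inr k) * R => F1 u.1 u.2).
  apply: measurable_funM; last exact: measurable_likelihood_ratio.
  apply: measurable_funM => //; apply: (measurableT_comp mg).
  exact: measurable_hybrid_set.
have mF2 : measurable_fun setT (fun u : others (inr k) * R => F2 u.1 u.2).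
  apply: measurable_funM => //; apply: (measurableT_comp mg).
  apply: (@measurable_hybrid_set n k (fun u => wrap_angle (m (X k u.1) + u.2))).
  apply: (measurableT_comp measurable_wrap_angle).
  by apply: measurable_funD => //; exact: (measurableT_comp mm).
have E1 := @integral_independent _ _ _ _ _ _ measurable_joint_family indep (inr k) _ _ F1
  mD (law_zeta k) mF1 F10.
have E2 := @integral_independent _ _ _ _ _ _ measurable_joint_family indep (inr k) _ _ F2
  mD (law_zeta k) mF2 F20.
have -> : (\int[P]_w (g (hybrid n k.+1 w) * partial_ratio k.+1 w)%:E
    = \int[P]_w (F1 w (zeta k w))%:E)%E.
  apply: eq_integral => w _.
  by rewrite /F1 hybrid_setS partial_ratioS mulrA.
have -> : (\int[P]_w (g (hybrid n k w) * partial_ratio k w)%:E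
    = \int[P]_w (F2 w (zeta k w))%:E)%E.
  by apply: eq_integral => w _; rewrite /F2 hybrid_set_wrap.
rewrite {}E1 {}E2; apply: ge0_le_integral_any => w _.
  by apply: integral_ge0 => z _; rewrite lee_fin mulr_ge0// noise_density_ge0.
pose F3 z := g (hybrid_set n k w (wrap_angle z)) * partial_ratio k w * p (z - m (X k w)).
have mF3 : measurable_fun setT F3.
  apply: measurable_funM.
    apply: measurable_funM => //; apply: (measurableT_comp mg).
    have := @measurable_hybrid_set n k (fun u => wrap_angle u.2).
    move=> /(_ (measurableT_comp measurable_wrap_angle measurable_snd)) h.
    exact: (measurableT_comp h (pair1_measurable (w : others (inr k)))).
  by apply: (measurableT_comp mp); exact: measurable_funB.
have F30 z : 0 <= F3 z.
  by rewrite mulr_ge0 ?noise_density_ge0// mulr_ge0// partial_ratio_ge0.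
have pF3 : periodic F3 (2 * pi).
  by move=> z; rewrite /F3 wrap_angleD2pi addrAC p_periodic.
have -> : (\int[leb]_(z in angles) (F2 w z * p z)%:E
    = \int[leb]_(z in angles) (F3 z)%:E)%E.
  rewrite -(integral_periodic_shift (m_bounds (X k w)) pF3 mF3 F30).
  by apply: eq_integral => z _; rewrite /F3 addrK /F2 addrC.
apply: ge0_le_integral_any => z; rewrite /angles/= => zin; rewrite lee_fin.
  by rewrite mulr_ge0// noise_density_ge0.
rewrite /F1 /F3 wrap_angle_id// -[leLHS]mulrA ler_wpM2l//.
  by rewrite mulr_ge0// partial_ratio_ge0.
rewrite /likelihood_ratio; have [->|pz] := eqVneq (p z) 0.
  by rewrite mulr0 noise_density_ge0.
by rewrite divfK.
Qed.

(** Change of measure between the two models.  It is an inequality because the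
    likelihood ratio ignores the singular part; with [g = 1] it says that the
    likelihood ratio has expectation at most one. *)
Lemma hybrid_chain n (g : n.-tuple (R * R) -> R) :
  measurable_fun setT g -> (forall y, 0 <= g y) ->
  (\int[P]_w (g (observations X zeta (cst 0) n w) * partial_ratio n w)%:E
    <= \int[P]_w (g (observations X zeta m n w))%:E)%E.
Proof.
move=> mg g0.
have H k : (\int[P]_w (g (hybrid n k w) * partial_ratio k w)%:E
    <= \int[P]_w (g (hybrid n 0 w) * partial_ratio 0 w)%:E)%E.
  by elim: k => // k IH; apply: le_trans IH; exact: hybrid_step.
apply: le_trans (le_trans (H n) _).
  rewrite le_eqVlt; apply/predU1P; left; apply: eq_integral => w _.
  congr (g _ * _)%:E; apply: eq_from_tnth => i; rewrite !tnth_mktuple ltn_ord.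
  by rewrite add0r wrap_angle_id.
rewrite le_eqVlt; apply/predU1P; left; apply: eq_integral => w _.
rewrite /partial_ratio big_ord0 mulr1.
by congr (g _)%:E; apply: eq_from_tnth => i; rewrite !tnth_mktuple.
Qed.

(** * Hellinger affinity of the two samples *)

Section Affinity.
(** [I] bounds the squared norm of [m], and [eps] the loss of Hellinger affinity
    caused by a single observation. *)
Variables (pstar theta0 mu0 I eps : R).
Hypothesis kl_quadratic : forall theta : R, `|theta| <= theta0 ->
  (kl_shift p theta <= (pstar * theta ^+ 2)%:E)%E.
Hypothesis m_small : forall t, m t <= theta0.
Hypothesis pstar_ge0 : 0 <= pstar.
Hypothesis pstar_m : forall t, pstar * m t ^+ 2 <= 2.
Hypothesis fX_le : forall t : R, t \in `[0, 1] -> fX t <= mu0.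
Hypothesis mu0_ge0 : 0 <= mu0.
Hypothesis energy : (\int[leb]_(t in `[0%R, 1%R]) (m t ^+ 2)%:E <= I%:E)%E.
Hypothesis eps_ge : pstar * mu0 * I / 2 <= eps.
Hypothesis eps_le1 : eps <= 1.

Lemma affinity_given_covariate t :
  ((1 - pstar * m t ^+ 2 / 2)%:E
   <= \int[leb]_(z in angles) (Num.sqrt (likelihood_ratio z t) * p z)%:E)%E.
Proof.
have /andP[m0 _] := m_bounds t.
have p1 : (\int[leb]_(z in angles) (p z)%:E = 1)%E.
  have [_ _ /(_ setT measurableT)] := law_zeta 0.
  by rewrite preimage_setT probability_setT setTI.
have := hellinger_affinity_ge measurable_noise_density noise_density_ge0
  p_periodic p1 (m_bounds t) (K := pstar * m t ^+ 2).
have klm := @kl_quadratic (- m t).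
rewrite sqrrN normrN ger0_norm// in klm; move=> /(_ (klm (m_small t))).
move=> /le_trans; apply.
rewrite le_eqVlt; apply/predU1P; left; apply: eq_integral => z _; congr (_%:E).
rewrite /likelihood_ratio; have [->|pz] := eqVneq (p z) 0.
  by rewrite mul0r sqrtr0 mulr0.
rewrite -[X in _ = _ * X](ger0_norm (noise_density_ge0 z)) -sqrtr_sqr -sqrtrM.
  by congr Num.sqrt; field.
by rewrite divr_ge0// noise_density_ge0.
Qed.

(** Written through its complement: the mass of [fX] is one, and the weighted
    mass of [m ^+ 2] is at most [mu0 * I]. *)
Lemma affinity_covariate :
  ((1 - eps)%:E
   <= \int[leb]_(t in `[0%R, 1%R]) ((1 - pstar * m t ^+ 2 / 2) * fX t)%:E)%E.
Proof.
have [mf f0 lawf] := law_X 0.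
have mD : measurable (`[0%R, 1%R]%classic : set R) by exact: measurable_itv.
have mm2 : measurable_fun (`[0%R, 1%R] : set R) (fun t => m t ^+ 2).
  by apply: measurable_funX; exact: measurable_funTS.
have f1 : (\int[leb]_(t in `[0%R, 1%R]) (fX t)%:E = 1)%E.
  have := lawf setT measurableT.
  by rewrite preimage_setT probability_setT setTI.
pose b t := pstar * m t ^+ 2 / 2.
have mb : measurable_fun (`[0%R, 1%R] : set R) b.
  by apply: measurable_funM => //; apply: measurable_funM.
have b0 t : 0 <= b t by rewrite divr_ge0// mulr_ge0// sqr_ge0.
have b1 t : b t <= 1 by have := pstar_m t; rewrite /b; lra.
have split1 : (\int[leb]_(t in `[0%R, 1%R]) ((1 - b t) * fX t)%:E
    + \int[leb]_(t in `[0%R, 1%R]) (b t * fX t)%:E = 1)%E.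
  rewrite -ge0_integralD//=; last 4 first.
  - by move=> t t01; rewrite lee_fin mulr_ge0// ?subr_ge0// f0.
  - by apply/measurable_EFinP; apply: measurable_funM => //; exact: measurable_funB.
  - by move=> t t01; rewrite lee_fin mulr_ge0// f0.
  - by apply/measurable_EFinP; exact: measurable_funM.
  by rewrite -f1; apply: eq_integral => t _; rewrite -EFinD; congr (_%:E); ring.
have bf : (\int[leb]_(t in `[0%R, 1%R]) (b t * fX t)%:E <= eps%:E)%E.
  apply: (@le_trans _ _ (\int[leb]_(t in `[0%R, 1%R])
      ((pstar * mu0 / 2)%:E * (m t ^+ 2)%:E))%E).
    apply: ge0_le_integral_any => t t01; first by rewrite lee_fin mulr_ge0// f0.
    rewrite -EFinM lee_fin.
    have -> : pstar * mu0 / 2 * m t ^+ 2 = b t * mu0 by rewrite /b; ring.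
    by rewrite ler_wpM2l// fX_le.
  have c0 : 0 <= pstar * mu0 / 2 by rewrite divr_ge0// mulr_ge0.
  rewrite ge0_integralZl_EFin//; last 2 first.
  - by move=> t _; rewrite lee_fin sqr_ge0.
  - exact/measurable_EFinP.
  apply: (@le_trans _ _ ((pstar * mu0 / 2)%:E * I%:E)%E).
    by apply: lee_wpmul2l => //; rewrite lee_fin.
  have cI : pstar * mu0 / 2 * I = pstar * mu0 * I / 2 by ring.
  by rewrite -EFinM lee_fin cI.
rewrite -/(b _); move: split1 bf.
set u := (\int[leb]_(t in _) ((1 - _) * _)%:E)%E.
set v := (\int[leb]_(t in _) (b _ * _)%:E)%E.
have u0 : (0 <= u)%E.
  by apply: integral_ge0 => t t01; rewrite lee_fin mulr_ge0// ?subr_ge0// f0.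
have v0 : (0 <= v)%E.
  by apply: integral_ge0 => t t01; rewrite lee_fin mulr_ge0// f0.
case: u u0 => [u||]//; case: v v0 => [v||]//= _ _; rewrite -EFinD => -[uv].
rewrite !lee_fin; lra.
Qed.

(** The affinity is multiplicative over independent observations: integrate
    out the [k]-th noise variable, then the [k]-th covariate. *)
Lemma affinity_step k :
  ((1 - eps)%:E * \int[P]_w (Num.sqrt (partial_ratio k w))%:E
   <= \int[P]_w (Num.sqrt (partial_ratio k.+1 w))%:E)%E.
Proof.
pose S w := Num.sqrt (partial_ratio k w).
have S0 w : 0 <= S w by exact: sqrtr_ge0.
have mS c : (forall i, (i < k)%N -> c != inl i) ->
    (forall i, (i < k)%N -> c != inr i) -> measurable_fun setT (S : others c -> R).
  move=> cl cr; apply: (measurableT_comp measurable_sqrtr).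
  exact: measurable_partial_ratio_others.
have kk i : (i < k)%N -> inr k != inr i :> nat + nat.
  by move=> ik; apply/eqP => -[ki]; rewrite ki ltnn in ik.
have kk' i : (i < k)%N -> inl k != inl i :> nat + nat.
  by move=> ik; apply/eqP => -[ki]; rewrite ki ltnn in ik.
pose F1 w z := S w * Num.sqrt (likelihood_ratio z (X k w)).
have F10 w z : 0 <= F1 w z by rewrite mulr_ge0// sqrtr_ge0.
have mF1 : measurable_fun setT (fun u : others (inr k) * R => F1 u.1 u.2).
  apply: measurable_funM.
    by apply: (measurableT_comp _ measurable_fst); apply: mS.
  apply: (measurableT_comp measurable_sqrtr).
  apply: measurable_likelihood_ratio => //.
  exact: (measurableT_comp (measurable_others_X _) measurable_fst).
pose F2 w t := S w * (1 - pstar * m t ^+ 2 / 2).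
have q0 t : 0 <= 1 - pstar * m t ^+ 2 / 2.
  by have := pstar_m t; lra.
have F20 w t : 0 <= F2 w t by rewrite mulr_ge0.
have mF2 : measurable_fun setT (fun u : others (inl k) * R => F2 u.1 u.2).
  apply: measurable_funM.
    by apply: (measurableT_comp _ measurable_fst); apply: mS.
  apply: measurable_funB => //; apply: measurable_funM => //.
  apply: measurable_funM => //; apply: measurable_funX.
  exact: (measurableT_comp mm measurable_snd).
have mD : measurable (angles : set R) by exact: measurable_itv.
have mD' : measurable (`[0%R, 1%R]%classic : set R) by exact: measurable_itv.
have E1 := @integral_independent _ _ _ _ _ _ measurable_joint_family indep (inr k) _ _ F1
  mD (law_zeta k) mF1 F10.
have E2 := @integral_independent _ _ _ _ _ _ measurable_joint_family indep (inl k) _ _ F2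
  mD' (law_X k) mF2 F20.
have -> : (\int[P]_w (Num.sqrt (partial_ratio k.+1 w))%:E
    = \int[P]_w (F1 w (zeta k w))%:E)%E.
  by apply: eq_integral => w _; rewrite partial_ratioS sqrtrM// partial_ratio_ge0.
rewrite E1; apply: (@le_trans _ _ (\int[P]_w (F2 w (X k w))%:E)%E).
  have mSP : measurable_fun setT (fun w => (S w)%:E).
    apply/measurable_EFinP; apply: (measurableT_comp measurable_sqrtr).
    exact: measurable_partial_ratio.
  rewrite E2 -ge0_integralZl//=; last by rewrite lee_fin subr_ge0.
  apply: ge0_le_integral_any => w _.
    by rewrite mule_ge0 ?lee_fin ?subr_ge0.
  have [mf f0 _] := law_X k.
  have -> : (\int[leb]_(t in `[0%R, 1%R]) (F2 w t * fX t)%:E = (S w)%:E *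
      \int[leb]_(t in `[0%R, 1%R]) ((1 - pstar * m t ^+ 2 / 2) * fX t)%:E)%E.
    rewrite -ge0_integralZl_EFin//.
    - by apply: eq_integral => t _; rewrite -EFinM mulrA.
    - by move=> t t01; rewrite lee_fin mulr_ge0// f0.
    - apply/measurable_EFinP; apply: measurable_funM => //; apply: measurable_funTS.
      apply: measurable_funB => //; apply: measurable_funM => //.
      by apply: measurable_funM => //; exact: measurable_funX.
  rewrite muleC; apply: lee_wpmul2l; first by rewrite lee_fin.
  exact: affinity_covariate.
apply: ge0_le_integral_any => w _; first by rewrite lee_fin.
have -> : (\int[leb]_(z in angles) (F1 w z * p z)%:E = (S w)%:E *
    \int[leb]_(z in angles) (Num.sqrt (likelihood_ratio z (X k w)) * p z)%:E)%E.
  rewrite -ge0_integralZl_EFin//.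
  - by apply: eq_integral => z _; rewrite -EFinM mulrA.
  - by move=> z _; rewrite lee_fin mulr_ge0 ?sqrtr_ge0 ?noise_density_ge0.
  - apply/measurable_EFinP; apply: measurable_funTS; apply: measurable_funM.
      apply: (measurableT_comp measurable_sqrtr).
      exact: measurable_likelihood_ratio.
    exact: measurable_noise_density.
rewrite /F2 EFinM; apply: lee_wpmul2l; first by rewrite lee_fin.
exact: affinity_given_covariate.
Qed.

Lemma affinity_chain k :
  (((1 - eps) ^+ k)%:E <= \int[P]_w (Num.sqrt (partial_ratio k w))%:E)%E.
Proof.
elim: k => [|k IH].
  rewrite expr0 (eq_integral (cst 1%E)); last first.
    by move=> w _; rewrite /partial_ratio big_ord0 sqrtr1.
  by rewrite integral_cst//= mul1e probability_setT.
apply: le_trans (affinity_step k); rewrite exprS EFinM.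
by apply: lee_wpmul2l => //; rewrite lee_fin subr_ge0.
Qed.

(** No estimator does well under both regression functions: the losses [d0]
    and [d1] never vanish together, and the two samples have affinity at least
    [1 / 2].  The constant [e / 8] is what [le_cam_pointwise] leaves after
    taking expectations: [e / 4] from the affinity, minus [e / 8] from the
    mass of the likelihood ratio. *)
Lemma two_point_bound n (d0 d1 : n.-tuple (R * R) -> R) e :
  measurable_fun setT d0 -> measurable_fun setT d1 ->
  (forall y, 0 <= d0 y) -> (forall y, 0 <= d1 y) ->
  0 <= e -> (forall y, e <= d0 y + d1 y) -> n%:R * eps <= 1 / 2 ->
  ((e / 8)%:E <= \int[P]_w (d0 (observations X zeta (cst 0%R) n w))%:E
     + \int[P]_w (d1 (observations X zeta m n w))%:E)%E.
Proof.
move=> md0 md1 d00 d10 e0 ed neps.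
pose L w := partial_ratio n w.
pose o w := observations X zeta (cst 0) n w.
have L0 w : 0 <= L w by exact: partial_ratio_ge0.
have mL : measurable_fun setT L by exact: measurable_partial_ratio.
have mo : measurable_fun setT o.
  apply/measurable_fun_tnthP => i.
  rewrite (_ : _ \o _ = fun w => (wrap_angle (0 + zeta i w), X i w)); last first.
    by apply/funext => w /=; rewrite tnth_mktuple.
  apply/measurable_fun_pair => //; apply: (measurableT_comp measurable_wrap_angle).
  exact: measurable_funD.
have EL : (\int[P]_w (L w)%:E <= 1)%E.
  have := @hybrid_chain n (cst 1) (measurable_cst _) (fun=> ler01).
  rewrite /= integral_cst//= mul1e probability_setT.
  by under eq_integral do rewrite mul1r.
have ES : ((1 / 2)%:E <= \int[P]_w (Num.sqrt (L w))%:E)%E.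
  apply: le_trans (affinity_chain n); rewrite lee_fin.
  (* Bernoulli's inequality *)
  have B k : 1 - k%:R * eps <= (1 - eps) ^+ k.
    elim: k => [|k IH]; first by rewrite mul0r subr0 expr0.
    have e1 : 0 <= 1 - eps by rewrite subr_ge0.
    have h := ler_wpM2l e1 IH; rewrite exprS; apply: le_trans h.
    have : 0 <= k%:R * eps ^+ 2 by rewrite mulr_ge0// sqr_ge0.
    rewrite -natr1; nra.
  by apply: le_trans (B n); lra.
have chain := hybrid_chain md1 d10.
have key : (\int[P]_w (e * Num.sqrt (L w) / 2)%:E
    <= \int[P]_w ((d0 (o w))%:E + (d1 (o w) * L w)%:E + (e / 16 * (1 + L w))%:E))%E.
  apply: ge0_le_integral_any => w _.
    by rewrite lee_fin divr_ge0// mulr_ge0// sqrtr_ge0.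
  rewrite -!EFinD lee_fin.
  have := le_cam_pointwise (d00 (o w)) (d10 (o w)) (L0 w) e0 (ed (o w)).
  lra.
have mE (f : Omega -> R) : measurable_fun setT f ->
    measurable_fun setT (fun w => (f w)%:E) by move=> ?; exact/measurable_EFinP.
have m0 : measurable_fun setT (fun w => d0 (o w)) by exact: (measurableT_comp md0).
have m1 : measurable_fun setT (fun w => d1 (o w) * L w).
  by apply: measurable_funM => //; exact: (measurableT_comp md1).
have m2 : measurable_fun setT (fun w => 1 + L w) by exact: measurable_funD.
have e16 : 0 <= e / 16 by rewrite divr_ge0.
have IL : (\int[P]_w (e / 16 * (1 + L w))%:E <= (e / 8)%:E)%E.
  under eq_integral do rewrite EFinM.
  rewrite ge0_integralZl_EFin//; last 2 first.
  - by move=> w _; rewrite lee_fin addr_ge0.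
  - exact: mE.
  under eq_integral do rewrite EFinD.
  rewrite ge0_integralD//; last 2 first.
  - by move=> w _; rewrite lee_fin.
  - exact: mE.
  rewrite integral_cst//= mul1e probability_setT.
  apply: (@le_trans _ _ ((e / 16)%:E * (1 + 1)%:E)%E).
    by apply: lee_wpmul2l; [rewrite lee_fin|rewrite EFinD leeD2l].
  by rewrite -EFinM lee_fin; lra.
move: key; rewrite ge0_integralD//; last 4 first.
- by move=> w _; rewrite -EFinD lee_fin addr_ge0// mulr_ge0.
- by apply: emeasurable_funD; exact: mE.
- by move=> w _; rewrite lee_fin mulr_ge0// addr_ge0.
- by apply: mE; exact: measurable_funM.
rewrite ge0_integralD//; last 4 first.
- by move=> w _; rewrite lee_fin.
- exact: mE.
- by move=> w _; rewrite lee_fin mulr_ge0.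
- exact: mE.
have -> : (\int[P]_w (e * Num.sqrt (L w) / 2)%:E
    = (e / 2)%:E * \int[P]_w (Num.sqrt (L w))%:E)%E.
  rewrite -ge0_integralZl_EFin//.
  - by apply: eq_integral => w _; rewrite -EFinM mulrAC.
  - by apply: mE; apply: (measurableT_comp measurable_sqrtr).
  - by rewrite divr_ge0.
have e2 : 0 <= e / 2 by rewrite divr_ge0.
have low : ((e / 2)%:E * (1 / 2)%:E <= (e / 2)%:E * \int[P]_w (Num.sqrt (L w))%:E)%E.
  by apply: lee_wpmul2l => //; rewrite lee_fin.
move=> key; have {key low} := le_trans low key.
move: chain IL.
have : (0 <= \int[P]_w (e / 16 * (1 + L w))%:E)%E.
  by apply: integral_ge0 => w _; rewrite lee_fin mulr_ge0// addr_ge0.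
move=> c0 chain c1 h.
apply: (@le_trans _ _ (\int[P]_w (d0 (o w))%:E
  + \int[P]_w (d1 (o w) * L w)%:E)%E); last first.
  exact: leeD2l.
move: c0 c1 h; rewrite -EFinM.
case: (\int[P]_w (e / 16 * (1 + L w))%:E)%E => [t||]// _ t8.
rewrite -leeBlDr// => /(le_trans _); apply.
by move: t8; rewrite -EFinB !lee_fin; lra.
Qed.

End Affinity.

End LikelihoodRatio.

(** * The bandwidth and the minimax bound *)

Section Rates.
Context {R : realType}.
Implicit Types (beta : R).

Lemma limn_einf_ge_eventually (u : (\bar R)^nat) (c : \bar R) (N : nat) :
  (forall n, (N <= n)%N -> c <= u n)%E -> (c <= limn_einf u)%E.
Proof.
move=> H; rewrite limn_einf_lim; apply: lime_ge; first exact: is_cvg_einfs.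
exists N => // n /= Nn; apply: le_ereal_inf_tmp => _ [k /= nk <-].
by apply: H; exact: leq_trans nk.
Qed.

(** With this bandwidth, a bump of height [bandwidth beta n `^ beta] has squared
    norm of order [1 / n], the largest order that [n] observations cannot
    detect. *)
Definition bandwidth beta (n : nat) : R := n%:R `^ (- (2 * beta + 1)^-1).

Lemma bandwidth_bounds beta n : 0 < beta -> (0 < n)%N -> 0 < bandwidth beta n <= 1.
Proof.
move=> b0 n0; have q0 : 0 < 2 * beta + 1 by rewrite addr_gt0// mulr_gt0.
rewrite /bandwidth powR_gt0 ?ltr0n//= powRN invf_le1 ?powR_gt0 ?ltr0n//.
by rewrite -[leLHS](powRr0 n%:R) ler_powR ?ler1n// invr_ge0 ltW//.
Qed.

Lemma bandwidth_energy beta n : 0 < beta -> (0 < n)%N ->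
  (bandwidth beta n `^ beta) ^+ 2 * bandwidth beta n = n%:R^-1.
Proof.
move=> b0 n0; have q0 : 2 * beta + 1 != 0 by rewrite gt_eqF// addr_gt0// mulr_gt0.
have nn : (n%:R : R) != 0 by rewrite pnatr_eq0 -lt0n.
rewrite /bandwidth -powRrM -powR_mulrn ?powR_ge0// -powRrM -powRD ?nn ?implybT//.
rewrite -[RHS]powR_inv1//; congr (_ `^ _); field.
by [].
Qed.

Lemma bandwidth_rate beta n : 0 < beta -> (0 < n)%N ->
  n%:R `^ (2 * beta / (2 * beta + 1)) * (bandwidth beta n `^ beta) ^+ 2 = 1.
Proof.
move=> b0 n0; have q0 : 2 * beta + 1 != 0 by rewrite gt_eqF// addr_gt0// mulr_gt0.
have nn : (n%:R : R) != 0 by rewrite pnatr_eq0 -lt0n.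
rewrite /bandwidth -powRrM -powR_mulrn ?powR_ge0// -powRrM -powRD ?nn ?implybT//.
rewrite (_ : _ + _ = 0) ?powRr0//; field.
by [].
Qed.

Lemma bandwidth_vanishes beta e : 0 < beta -> 0 < e ->
  exists N, forall n, (N <= n)%N -> bandwidth beta n `^ beta <= e.
Proof.
move=> b0 e0; have q0 : 0 < 2 * beta + 1 by rewrite addr_gt0// mulr_gt0.
pose s := beta / (2 * beta + 1).
have s0 : 0 < s by rewrite divr_gt0.
have C0 : 0 < e^-1 `^ s^-1 by rewrite powR_gt0 ?invr_gt0.
exists (Num.bound (e^-1 `^ s^-1)) => n nN.
have nC : e^-1 `^ s^-1 <= n%:R.
  by apply: ltW; apply: lt_le_trans (archi_boundP (ltW C0)) _; rewrite ler_nat.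
have n0 : 0 < n%:R :> R by exact: lt_le_trans C0 nC.
rewrite /bandwidth -powRrM mulNr mulrC -/s powRN -[leRHS]invrK.
rewrite lef_pV2 ?posrE ?powR_gt0 ?invr_gt0//.
apply: (@le_trans _ _ ((e^-1 `^ s^-1) `^ s)).
  by rewrite -powRrM mulVf ?(gt_eqF s0)// powRr1 ?invr_ge0 ?(ltW e0).
by rewrite ge0_ler_powR// ?nnegrE ltW.
Qed.

Lemma le_half_of_sum (a b s : \bar R) (c : R) : (c%:E <= a + b)%E ->
  (0 <= a)%E -> (0 <= b)%E -> (a <= s)%E -> (b <= s)%E -> ((c / 2)%:E <= s)%E.
Proof.
move=> cab a0 b0 as_ bs; have := le_trans cab (leeD as_ bs).
case: s as_ bs => [s||] // as_ bs.
- by rewrite -EFinD !lee_fin; lra.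
- by move=> _; exact: leey.

Qed.

End Rates.

Theorem theorem3p11 (R : realType) (beta L pstar mu0 : R)
    (beta_gt0 : 0 < beta) (L_gt0 : 0 < L) (pstar_gt0 : 0 < pstar) :
  exists2 c : R, 0 < c &
    forall (d : measure_display) (Omega : measurableType d)
      (P : probability Omega R) (X zeta : nat -> {RV P >-> R})
      (fX pzeta : R -> R) (theta0 x : R),
    x \in `[0, 1] ->
    (forall i w, X i w \in `[0, 1]) ->
    (forall i w, angles (zeta i w)) ->
    mutually_independent P (joint_family X zeta) ->
    (forall i, has_density_on P `[0, 1] (X i) fX) ->
    (forall t : R, t \in `[0, 1] -> fX t <= mu0) ->
    (forall i, has_density_on P angles (zeta i) pzeta) ->
    periodic pzeta (2 * pi) ->
    (forall i, centered P (zeta i)) ->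
    0 < theta0 ->
    (forall theta : R, `|theta| <= theta0 ->
       (kl_shift pzeta theta <= (pstar * theta ^+ 2)%:E)%E) ->
    (c%:E <= limn_einf (minimax_risk P X zeta beta L x))%E.
Proof.
have [a0 a0_gt0 bump_in] := scaled_bump_Sigma_tilde beta_gt0 L_gt0.
(* A bound [mu0] of a probability density on [[0, 1]] is at least [1], but this
   is known only once the density is given, after the constant is chosen. *)
pose mu := Num.max mu0 1.
have mu1 : 1 <= mu by rewrite le_max lexx orbT.
have pm0 : 0 < pstar * mu by rewrite mulr_gt0// (lt_le_trans _ mu1).
pose a := Num.min a0 (1 + pstar * mu)^-1.
have a_gt0 : 0 < a by rewrite lt_min a0_gt0 invr_gt0 addr_gt0.
have aa0 : a <= a0 by rewrite ge_min lexx.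
have ai : a <= (1 + pstar * mu)^-1 by rewrite ge_min lexx orbT.
have a1 : a <= 1.
  by apply: le_trans ai _; rewrite invf_le1 ?addr_gt0// lerDl ltW.
have apm : pstar * mu * a ^+ 2 <= 1.
  have h : a * (1 + pstar * mu) <= 1.
    by move: ai; rewrite -[X in _ <= X]div1r ler_pdivlMr// addr_gt0.
  rewrite expr2; nra.
(* [16 ^+ 3] collects the factor [16] of the peak height [A / 4] squared, the
   [16] of [d_c_separation], the [8] of [two_point_bound], and the [2] from
   passing from the sum of the two risks to the larger one. *)
exists (a ^+ 2 / 16 ^+ 3); first by rewrite divr_gt0 ?exprn_gt0.
move=> d Omega P X zeta fX p theta0 x x01 X01 zeta_angles indep law_X fX_le
  law_zeta p_periodic _ theta0_gt0 kl_quadratic.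
have [N bandN] := bandwidth_vanishes beta_gt0 theta0_gt0.
apply: (@limn_einf_ge_eventually _ _ _ N.+1) => n Nn.
have n0 : (0 < n)%N by exact: leq_trans Nn.
apply: le_ereal_inf_tmp => _ [T /(_ x x01) [mT _] <-].
set h := bandwidth beta n.
have h01 : 0 < h <= 1 by exact: bandwidth_bounds.
have /andP[h0 h1] := h01.
pose A := a * h `^ beta.
have hb0 : 0 <= h `^ beta by exact: powR_ge0.
have hb1 : h `^ beta <= 1.
  have <- : 1 `^ beta = 1 :> R by rewrite powR1.
  by rewrite ge0_ler_powR// ?nnegrE// ltW.
have A0 : 0 <= A by rewrite mulr_ge0// ltW.
have A1 : A <= 1 by rewrite -[leRHS]mulr1 ler_pM// ltW.
pose m := scaled_bump A h x 0.
have m_in : Sigma_tilde beta L m by apply: bump_in => //; rewrite ltW.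
have m0_in : Sigma_tilde beta L (cst 0).
  rewrite (_ : cst 0 = scaled_bump (0 * h `^ beta) h x 0).
    by apply: bump_in => //; rewrite lexx ltW.
  by apply/funext => t; rewrite scaled_bump0E !mul0r.
have mb t : 0 <= m t <= A / 4 by exact: scaled_bump_bounds.
have m2pi t : 0 <= m t <= 2 * pi.
  have /andP[-> /= mt] := mb t.
  have := @pi_ge2 R; lra.
have m_theta0 t : m t <= theta0.
  have /andP[_ mt] := mb t; apply: le_trans mt _.
  have : h `^ beta <= theta0 by apply: bandN; exact: ltnW.
  have : A <= h `^ beta by rewrite /A ler_piMl.
  lra.
have sqrA : A ^+ 2 <= a ^+ 2.
  have Aa : A <= a by rewrite /A ler_piMr// ltW.
  by rewrite lerXn2r ?nnegrE// ltW.
have pm t : pstar * m t ^+ 2 <= 2.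
  have /andP[mt0 mt] := mb t.
  have : m t ^+ 2 <= a ^+ 2.
    by apply: le_trans sqrA; rewrite lerXn2r ?nnegrE//; lra.
  have := sqr_ge0 a.
  have : pstar * a ^+ 2 <= pstar * mu * a ^+ 2.
    by rewrite ler_wpM2r ?sqr_ge0// ler_peMr// ltW.
  nra.
have fX_mu t : t \in `[0, 1] -> fX t <= mu.
  by move=> /fX_le ft; rewrite le_max ft.
have energy : (\int[lebesgue_measure]_(t in `[0%R, 1%R]) (m t ^+ 2)%:E
    <= (A ^+ 2 * h)%:E)%E by exact: integral_sqr_scaled_bump.
have AhE : A ^+ 2 * h = a ^+ 2 / n%:R.
  by rewrite /A exprMn -mulrA bandwidth_energy.
(* Over [n] observations the affinity lost is [1 / 2] in total. *)
pose eps : R := (2 * n%:R)^-1.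
have nR : 0 < n%:R :> R by rewrite ltr0n.
have eps_ge : pstar * mu * (A ^+ 2 * h) / 2 <= eps.
  rewrite AhE /eps invfM.
  have -> : pstar * mu * (a ^+ 2 / n%:R) / 2 = pstar * mu * a ^+ 2 * (2^-1 * n%:R^-1).
    by field; rewrite gt_eqF.
  by rewrite ler_piMl// mulr_ge0// invr_ge0 ltW.
have eps_le1 : eps <= 1.
  by rewrite invf_le1 ?mulr_gt0// (le_trans _ (ler_peMl _ _))// ?ler1n// ltW.
have neps : n%:R * eps <= 1 / 2.
  by rewrite /eps invfM mulrCA divff ?gt_eqF// mulr1 div1r.
(* The two-point bound is applied to losses already multiplied by the rate. *)
pose rate : R := n%:R `^ (2 * beta / (2 * beta + 1)).
have rate0 : 0 <= rate by exact: powR_ge0.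
pose u := A / 4.
have u01 : 0 <= u <= 1 by rewrite /u; apply/andP; split; lra.
pose d0 y := rate * d_c (T y x) 0.
pose d1 y := rate * d_c (T y x) u.
have md v : measurable_fun setT (fun y => rate * d_c (T y x) v).
  apply: measurable_funM => //; apply: measurable_funB => //.
  apply: (measurableT_comp (continuous_measurable_fun (@continuous_cos R))).
  exact: measurable_funB.
have d00 y v : 0 <= rate * d_c (T y x) v by rewrite mulr_ge0// d_c_ge0.
have sep y : rate * (u ^+ 2 / 16) <= d0 y + d1 y.
  by rewrite -mulrDr ler_wpM2l// d_c_separation.
have e0 : 0 <= rate * (u ^+ 2 / 16) by rewrite mulr_ge0// divr_ge0// sqr_ge0.
have mm : measurable_fun setT m by exact: measurable_scaled_bump.
have mu_ge0 : 0 <= mu by exact: le_trans mu1.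
have two := two_point_bound indep zeta_angles law_X law_zeta p_periodic mm m2pi
  kl_quadratic m_theta0 (ltW pstar_gt0) pm fX_mu mu_ge0 energy eps_ge eps_le1
  (md 0) (md u) (d00^~ 0) (d00^~ u) e0 sep neps.
have cE : a ^+ 2 / 16 ^+ 3 = (rate * (u ^+ 2 / 16) / 8) / 2.
  have -> : rate * (u ^+ 2 / 16) / 8 / 2 = (rate * (h `^ beta) ^+ 2) * a ^+ 2 / 16 ^+ 3.
    by rewrite /u /A; field.
  by rewrite bandwidth_rate// mul1r.
rewrite cE; apply: (le_half_of_sum two).
- by apply: integral_ge0 => w _; rewrite lee_fin.
- by apply: integral_ge0 => w _; rewrite lee_fin.
- by apply: ereal_sup_ubound; exists (cst 0) => //; rewrite /scaled_risk unlock.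
- apply: ereal_sup_ubound; exists m => //.
  by rewrite /scaled_risk unlock /u -(scaled_bump_peak A h x).
Qed.
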